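(* Let $R=k[x_0,\ldots,x_n]$ be a polynomial ring over a field $k$ of any characteristic, let $1\le c<s$ be integers, and let $\mathcal F=\{F_1,\ldots,F_s\}$ be a set of $s$ forms in $R$, all of the same degree $\delta$, such that any $c+1$ of them form a regular sequence. Let $I_{c,\mathcal F}=\bigcap_{1\le j_1<\cdots<j_c\le s}(F_{j_1},\ldots,F_{j_c})$. Fix $m\ge1$. (1) For any integer $t>m/2$, the ideal $I_{c,\mathcal F}^{(m)}$ has $$\binom{s}{c-1}\binom{m-t+c-2}{m-t}$$ minimal generators of degree $\delta(t(s-c)+m)$. (2) If $t=m/2$ and $m$ is even, then $I_{c,\mathcal F}^{(m)}$ has $$\binom{s}{c-2}+\binom{s}{c-1}\left(\binom{c-2+t}{t}-(c-1)\right)$$ minimal generators of degree $\delta(t(s-c)+m)$.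
   Context: For a homogeneous ideal $I\subseteq R$ and $m\ge1$, $I^{(m)}=\bigcap_{P\in \mathrm{Ass}(R/I)}(I^mR_P\cap R)$. Conventions: $\binom{a}{b}=0$ for $b<0$, and $\binom a0=1$ for every integer $a$. *)

(* Defs.v *)
From HB Require Import structures.
From mathcomp Require Import all_boot all_order all_algebra.
From mathcomp Require Import mpoly.

Set Implicit Arguments.
Unset Strict Implicit.
Unset Printing Implicit Defensive.

Import GRing.Theory.
Local Open Scope ring_scope.

(* Ideals are Prop-valued predicates, considered up to pointwise equivalence;
   the ideals of mathcomp's ring_quotient are decidable and proper, whereas
   [ideal_gen S], [ideal_pow I 0] and symbolic powers may be the whole ring. *)

(* The C-linear span of S; for a subring C of A it is the C-submodule of A
   generated by S. *)
Definition span_over (A : comNzRingType) (C S : A -> Prop) (f : A) : Prop :=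
  exists l : seq (A * A),
    (forall x, x \in l -> C x.1 /\ S x.2) /\ f = \sum_(x <- l) x.1 * x.2.

Definition ideal_gen (R : comNzRingType) (S : R -> Prop) : R -> Prop :=
  span_over (fun _ => True) S.

Definition ideal_pow (R : comNzRingType) (I : R -> Prop) (m : nat) : R -> Prop :=
  ideal_gen (fun f =>
    exists v : 'I_m -> R, (forall i, I (v i)) /\ f = \prod_(i < m) v i).

Definition is_ideal (R : comNzRingType) (P : R -> Prop) : Prop :=
  [/\ P 0, forall f g, P f -> P g -> P (f + g) & forall r f, P f -> P (r * f)].

Definition prime_ideal (R : comNzRingType) (P : R -> Prop) : Prop :=
  [/\ is_ideal P, ~ P 1 & forall f g, P (f * g) -> P f \/ P g].

(* P \in Ass(R/I): P is a prime ideal, and the annihilator of the class of some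
   f in R/I. *)
Definition associated_prime (R : comNzRingType) (I P : R -> Prop) : Prop :=
  prime_ideal P /\ exists f, forall g, P g <-> I (g * f).

(* R is a domain, so R_P and the ideals I R_P are taken inside Frac(R). *)
Definition localization (R : idomainType) (P : R -> Prop) :
    {fraction R} -> Prop :=
  fun u => exists a b : R, ~ P b /\ u = tofrac a / tofrac b.

Definition ideal_extension (R : idomainType) (P I : R -> Prop) :
    {fraction R} -> Prop :=
  span_over (localization P) (fun u => exists a : R, I a /\ u = tofrac a).

Definition symbolic_power (R : idomainType) (I : R -> Prop) (m : nat) :
    R -> Prop :=
  fun f => forall P : R -> Prop, associated_prime I P ->
    ideal_extension P (ideal_pow I m) (tofrac f).

(* The last condition says that R/(s) is nonzero. *)
Definition regular_sequence (R : comNzRingType) (s : seq R) : Prop :=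
  (forall i, (i < size s)%N -> forall f : R,
     ideal_gen (fun g => g \in take i s) (s`_i * f) ->
     ideal_gen (fun g => g \in take i s) f) /\
  ~ ideal_gen (fun g => g \in s) 1.

(* I_{c,F}, the intersection over all c-element subsets J of the indices of the
   ideals (F_j : j \in J). *)
Definition star_ideal (R : comNzRingType) (s c : nat) (F : 'I_s -> R) :
    R -> Prop :=
  fun f => forall J : {set 'I_s}, #|J| = c ->
    ideal_gen (fun g => exists2 j, j \in J & g = F j) f.

Definition generates (R : comNzRingType) (J : R -> Prop) (G : seq R) : Prop :=
  forall f, J f <-> ideal_gen (fun g => g \in G) f.

Definition minimal_homog_generators (n : nat) (k : fieldType)
    (J : {mpoly k[n]} -> Prop) (G : seq {mpoly k[n]}) : Prop :=
  [/\ uniq G,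
      forall g, g \in G -> exists d, g \is d.-homog,
      generates J G &
      forall G' : seq {mpoly k[n]},
        {subset G' <= G} -> generates J G' -> {subset G <= G'}].

(* J has a finite minimal system of homogeneous generators, and every such
   system contains exactly N elements of degree d.  The zero polynomial, which
   is homogeneous of every degree, belongs to no minimal system. *)
Definition has_min_generators_of_degree (n : nat) (k : fieldType)
    (J : {mpoly k[n]} -> Prop) (d : nat) (N : int) : Prop :=
  (exists G, minimal_homog_generators J G) /\
  (forall G, minimal_homog_generators J G ->
     (count (fun g : {mpoly k[n]} => g \is d.-homog) G)%:Z = N).

(* Binomial coefficients of integers: 0 for b < 0, and otherwise
   a (a-1) ... (a-b+1) / b!, which for a = -(a'+1) is (-1)^b binom(a'+b, b). *)
Definition binz (a b : int) : int :=
  match b, a with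
  | Negz _, _ => 0
  | Posz b', Posz a' => 'C(a', b')%:Z
  | Posz b', Negz a' => (-1) ^+ b' * 'C(a' + b', b')%:Z
  end.

(* Main.v *)
Require Import Defs.
From mathcomp Require Import all_boot all_order all_algebra.
From mathcomp Require Import mpoly.
From Stdlib Require Import Classical ClassicalEpsilon.
From mathcomp Require Import zify ring.

Local Open Scope ring_scope.
Set Implicit Arguments.
Unset Strict Implicit.
Unset Printing Implicit Defensive.

Import GRing.Theory.

(** If the [F i] were the variables of a polynomial ring, the [m]-th symbolic
    power of the star ideal would be the intersection over all [c]-subsets [J]
    of the powers [P_J ^ m] of the monomial primes [P_J = (F j : j in J)], hence
    spanned by the monomials [F^a] all of whose partial degrees
    [\sum_(j in J) a j], [#|J| = c], are at least [m].  The minimal exponents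
    among these are the vectors with maximal value [t], at least [s - c + 1]
    entries equal to [t], and total degree [t (s - c) + m]; counting them gives
    both formulas.  The proof shows that forms any [c + 1] of which are a regular
    sequence behave in the same way, although all [s] of them together need not
    be a regular sequence and the [P_J] need not be prime.

    The ideals [Q(J, b) = (F_j ^ b_j : j in J)] with [#|J| <= c] carry the
    argument.  Because a further form is still regular modulo [(F_j : j in J)],
    multiplication by any [F_i] can be cancelled modulo [Q(J, b)] as it would be
    for variables ([pure_power_colon_monom]).  There are four steps.

    - An element [f] of the symbolic power lies in [Q(J, e + 1)] whenever
      [\sum_(j in J) e j < m] ([symbolic_power_in_pure_power]).  Otherwise the
      colon ideal [Q(J, e + 1) : f] is contained in some [P_J : r] with
      [r] outside [P_J], and Hilbert's basis theorem provides an associated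
      prime of [R / P_J] above it.  This prime is also associated to the star
      ideal, and [f] does not lie in the localized power there.

    - An element of all these [Q(J, e + 1)] is a combination of monomials [F^a]
      of order at least [m] ([in_order_ideal]).  The exponents of order below
      [m] are divided into finitely many cells, each the translate of an orthant
      that leaves the coordinates in some [c]-subset [J] fixed.  The apexes [u]
      of the cells are discarded one by one, in an order such that what remains
      lies in [Q(J, u + 1)] and contains [F^u P_J].  Cancelling [F^u] shows that
      its coefficient lies in [P_J], so that its contribution to [f] can be
      rewritten in terms of the remaining monomials.

    - A minimal [F^u] lies outside an ideal [Q(J, u + 1)] that contains all the
      others, so that these monomials are a minimal system of generators; and two
      minimal homogeneous systems of generators have equally many elements in
      each degree ([minimal_count_eq]).

    - The minimal exponents with maximum [t] are sorted by the set [Z] of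
      coordinates where they are smaller than [t].  If [m < 2 t], this set has
      exactly [c - 1] elements, and if [m = 2 t] it has [c - 1] or [c - 2]. *)

(** * Ideals given by generators *)

Section Ideals.

Variable R : comNzRingType.
Implicit Types (S I : R -> Prop) (f g r : R).

Lemma idealB I : is_ideal I -> forall f g, I f -> I g -> I (f - g).
Proof. by case=> _ ID IM f g If Ig; apply: ID => //; rewrite -mulN1r; apply: IM. Qed.

Lemma colon_ideal I r : is_ideal I -> is_ideal (fun x => I (r * x)).
Proof.
case=> I0 ID IM; split=> [|f g If Ig|a f If]; first by rewrite mulr0.
  by rewrite mulrDr; apply: ID.
by rewrite mulrCA; apply: IM.
Qed.

Lemma ideal_sum I : is_ideal I ->
  forall (T : eqType) (s : seq T) (h : T -> R),
  (forall t, t \in s -> I (h t)) -> I (\sum_(t <- s) h t).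
Proof.
case=> I0 ID IM T s h Ih; rewrite big_seq.
by apply: (big_ind I) => // t /Ih.
Qed.

Lemma ideal_gen_ideal S : is_ideal (ideal_gen S).
Proof.
split.
- by exists [::]; split; rewrite ?big_nil.
- move=> _ _ [l [Sl ->]] [l' [Sl' ->]]; exists (l ++ l'); split.
    by move=> x; rewrite mem_cat => /orP[/Sl|/Sl'].
  by rewrite big_cat.
- move=> r _ [l [Sl ->]]; exists [seq (r * x.1, x.2) | x <- l]; split.
    by move=> x /mapP[y /Sl[_ Sy] ->]; split.
  by rewrite big_map mulr_sumr; apply: eq_bigr => x _ /=; rewrite mulrA.
Qed.

Lemma ideal_gen_mem S f : S f -> ideal_gen S f.
Proof.
move=> Sf; exists [:: (1, f)]; split; last by rewrite big_seq1 mul1r.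
by move=> x; rewrite inE => /eqP ->.
Qed.

Lemma ideal_gen_min S I : is_ideal I -> (forall f, S f -> I f) ->
  forall f, ideal_gen S f -> I f.
Proof.
move=> I_id SI _ [l [Sl ->]]; apply: ideal_sum => // x /Sl[_ Sx].
by case: I_id => _ _; apply; apply: SI.
Qed.

(** An induction principle for properties that are additive but not stable under
    multiplication by ring elements. *)
Lemma ideal_gen_terms S (P : R -> Prop) : P 0 ->
  (forall f g, P f -> P g -> P (f + g)) -> (forall r g, S g -> P (r * g)) ->
  forall f, ideal_gen S f -> P f.
Proof.
move=> P0 PD PS _ [l [Sl ->]]; rewrite big_seq.
by apply: (big_ind P) => // x /Sl[_ Sx]; apply: PS.
Qed.

Lemma ideal_gen_sub S S' : (forall f, S f -> S' f) ->
  forall f, ideal_gen S f -> ideal_gen S' f.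
Proof.
by move=> SS'; apply: ideal_gen_min (ideal_gen_ideal _) _ => f /SS' /ideal_gen_mem.
Qed.

Lemma ideal_gen0 S : ideal_gen S 0.
Proof. by case: (ideal_gen_ideal S). Qed.

Lemma ideal_genD S f g : ideal_gen S f -> ideal_gen S g -> ideal_gen S (f + g).
Proof. by case: (ideal_gen_ideal S) => _ + _; apply. Qed.

Lemma ideal_genB S f g : ideal_gen S f -> ideal_gen S g -> ideal_gen S (f - g).
Proof. exact: idealB (ideal_gen_ideal S) f g. Qed.

Lemma ideal_genM S r f : ideal_gen S f -> ideal_gen S (r * f).
Proof. by case: (ideal_gen_ideal S) => _ _; apply. Qed.

Lemma ideal_genU1 S x f :
  ideal_gen (fun g => S g \/ g = x) f <-> exists r, ideal_gen S (f - r * x).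
Proof.
split=> [|[r Sr]].
  move: f; apply: ideal_gen_min => [|g [Sg|->]]; last 2 first.
  - by exists 0; rewrite mul0r subr0; apply: ideal_gen_mem.
  - by exists 1; rewrite mul1r subrr; apply: ideal_gen0.
  split=> [|g h [r Sg] [r' Sh]|a g [r Sg]].
  - by exists 0; rewrite mul0r subr0; apply: ideal_gen0.
  - exists (r + r'); have -> : g + h - (r + r') * x = g - r * x + (h - r' * x) by ring.
    exact: ideal_genD.
  - exists (a * r); have -> : a * g - a * r * x = a * (g - r * x) by ring.
    exact: ideal_genM.
rewrite -(subrK (r * x) f); apply: ideal_genD.
  by apply: ideal_gen_sub Sr => g; left.
by apply/ideal_genM/ideal_gen_mem; right.
Qed.

Lemma ideal_powS I m x f : I x -> ideal_pow I m f -> ideal_pow I m.+1 (x * f).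
Proof.
move=> Ix; move: f; apply: ideal_gen_min => [|f [v [Iv ->]]].
  exact/colon_ideal/ideal_gen_ideal.
apply: ideal_gen_mem; exists (fun i => oapp v x (unlift ord0 i)); split.
  by move=> i; case: unliftP => [j|] _ /=.
rewrite big_ord_recl unlift_none; congr (_ * _).
by apply: eq_bigr => i _; rewrite liftK.
Qed.

Lemma ideal_pow0 I f : ideal_pow I 0 f.
Proof.
rewrite -(mulr1 f); apply/ideal_genM/ideal_gen_mem.
by exists (fun _ => 0); split=> [[]|] //; rewrite big_ord0.
Qed.

End Ideals.

(** * Ideals generated by powers of forms *)

Lemma sum_decr (T : finType) (P : pred T) (a : T -> nat) j : P j -> (0 < a j)%N ->
  (\sum_(i | P i) (a i - (i == j))).+1 = (\sum_(i | P i) a i)%N.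
Proof.
move=> Pj aj; rewrite (bigD1 j) //= [RHS](bigD1 j) //= eqxx -addSn subn1 prednK //.
by congr (_ + _)%N; apply: eq_bigr => i /andP[_ /negPf ->]; rewrite subn0.
Qed.

Definition monom (R : comNzRingType) (s : nat) (F : 'I_s -> R) (a : 'I_s -> nat) : R :=
  \prod_i F i ^+ a i.

(** For [b = 1] on [A] this is [P_A = (F j : j in A)]. *)
Definition pure_power_ideal (R : comNzRingType) (s : nat) (F : 'I_s -> R)
    (A : {set 'I_s}) (b : 'I_s -> nat) : R -> Prop :=
  ideal_gen (fun g => exists2 j, j \in A & g = F j ^+ b j).

Section PurePowers.

Variables (R : comNzRingType) (s : nat) (F : 'I_s -> R).
Local Notation mon := (monom F).
Local Notation Q := (pure_power_ideal F).
Local Notation PJ A := (pure_power_ideal F A (fun=> 1%N)).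
Implicit Types (A : {set 'I_s}) (a b u : 'I_s -> nat) (f g r x : R).

Lemma eq_monom a b : a =1 b -> mon a = mon b.
Proof. by move=> eq_ab; apply: eq_bigr => i _; rewrite eq_ab. Qed.

Lemma monomD a b : mon (fun i => a i + b i)%N = mon a * mon b.
Proof. by rewrite -big_split; apply: eq_bigr => i _; rewrite exprD. Qed.

Lemma monom0 : mon (fun=> 0%N) = 1.
Proof. by apply: big1 => i _; rewrite expr0. Qed.

Lemma monom1 j : mon (fun i => (i == j)%N) = F j.
Proof.
rewrite /monom (bigD1 j) //= eqxx expr1 big1 ?mulr1 // => i /negPf ->.
by rewrite expr0.
Qed.

Lemma monom_le a b : (forall i, a i <= b i)%N ->
  mon b = mon (fun i => b i - a i)%N * mon a.
Proof. by move=> le_ab; rewrite -monomD; apply: eq_monom => i; rewrite subnK. Qed.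

Lemma monom_split a j : (0 < a j)%N ->
  mon a = F j * mon (fun i => a i - (i == j))%N.
Proof.
move=> a_gt0; rewrite (@monom_le (fun i => (i == j) : nat)) ?monom1 1?mulrC //.
by move=> i; case: eqP => [->|].
Qed.

Lemma pure_power_mem A b j : j \in A -> Q A b (F j ^+ b j).
Proof. by move=> Aj; apply: ideal_gen_mem; exists j. Qed.

Lemma pure_power_le A A' b b' : {subset A <= A'} ->
  (forall j, j \in A -> b' j <= b j)%N -> forall f, Q A b f -> Q A' b' f.
Proof.
move=> sAA' le_b; apply: ideal_gen_min (ideal_gen_ideal _) _ => _ [j Aj ->].
by rewrite -(subnK (le_b j Aj)) exprD; apply/ideal_genM/pure_power_mem/sAA'.
Qed.

Lemma monom_in_pure_power A b a j : j \in A -> (b j <= a j)%N -> Q A b (mon a).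
Proof.
move=> Aj le_ba; rewrite /monom (bigD1 j) //= mulrC -(subnK le_ba) exprD.
by do 2!apply/ideal_genM; apply: pure_power_mem.
Qed.

Lemma pure_power_split i A b f : i \in A ->
  Q A b f <-> exists r, Q (A :\ i) b (f - r * F i ^+ b i).
Proof.
move=> Ai; rewrite -ideal_genU1; split; apply: ideal_gen_sub => g.
  case=> j Aj ->; have [->|ne_ji] := eqVneq j i; first by right.
  by left; exists j; rewrite ?in_setD1 ?ne_ji.
case=> [[j /setD1P[_ Aj] ->]|->]; first by exists j.
by exists i.
Qed.

Lemma pure_power_mulF i A b b' x : (forall j, j \in A -> b j <= b' j + (j == i))%N ->
  Q A b' x -> Q A b (F i * x).
Proof.
move=> le_b; move: x; apply: ideal_gen_min => [|_ [j Aj ->]].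
  exact/colon_ideal/ideal_gen_ideal.
have := le_b j Aj; case: eqP => [<-|_]; rewrite ?addn1 ?addn0 => le_bj.
  by rewrite -exprS -(subnK le_bj) exprD; apply/ideal_genM/pure_power_mem.
by rewrite -(subnK le_bj) exprD mulrA; apply/ideal_genM/pure_power_mem.
Qed.

Variable c : nat.
Hypothesis F_nzd : forall A l r, (#|A| <= c)%N -> l \notin A ->
  PJ A (F l * r) -> PJ A r.

(** By induction on the sum of the exponents.  Let [F_i ^ (e + 1)] be a generator
    with [e > 0].  When its exponent is lowered to 1, induction gives [r = p F_i]
    modulo the other generators.  Then [F_i] cancels from [F_l p F_i] modulo the
    other generators, so that [F_l p] lies in the ideal with exponent [e] at [i],
    and induction applies to [p]. *)
Lemma pure_power_nzd A b l r : (#|A| <= c)%N -> l \notin A ->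
  (forall j, j \in A -> 0 < b j)%N -> Q A b (F l * r) -> Q A b r.
Proof.
have [N] := ubnP (\sum_(j in A) b j); elim: N => // N IHN in A b l r *.
rewrite ltnS => le_bN cA lA b_gt0 Qlr.
have [/exists_inP[i Ai b_gt1]|] := boolP [exists i in A, 1 < b i]%N; last first.
  move=> b_le1; have b1 j : j \in A -> b j = 1%N.
    move=> Aj; apply/eqP; rewrite eqn_leq b_gt0 // andbT leqNgt.
    by apply: contra b_le1 => b_gt1; apply/exists_inP; exists j.
  have Qb1 f : Q A b f <-> PJ A f by split; apply: pure_power_le => // j Aj; rewrite b1.
  by apply/Qb1/(F_nzd (l := l)) => //; apply/Qb1.
pose b1 j := if j == i then 1%N else b j.
pose b' j := (b j - (j == i))%N.
have b1_gt0 j : j \in A -> (0 < b1 j)%N by rewrite /b1; case: eqP => // _ /b_gt0.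
have b'_gt0 j : j \in A -> (0 < b' j)%N.
  by rewrite /b'; case: eqP => [->|_ /b_gt0]; rewrite ?subn0 ?subn_gt0.
have sumA (h : 'I_s -> nat) : (\sum_(j in A) h j = h i + \sum_(j in A :\ i) h j)%N.
  by rewrite (bigD1 i) //=; congr (_ + _)%N; apply: eq_bigl => j; rewrite in_setD1 andbC.
have off (h h' : 'I_s -> nat) : (forall j, j != i -> h j = h' j) ->
    \sum_(j in A :\ i) h j = (\sum_(j in A :\ i) h' j)%N.
  by move=> E; apply: eq_bigr => j /setD1P[/E].
have lt_b1 : (\sum_(j in A) b1 j < N)%N.
  apply: leq_trans le_bN; rewrite !sumA (off b1 b) /b1 ?eqxx; first by lia.
  by move=> j /negPf ->.
have lt_b' : (\sum_(j in A) b' j < N)%N by rewrite sum_decr // ltnW.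
have lt_D : (\sum_(j in A :\ i) b j < N)%N by apply: leq_trans le_bN; rewrite sumA; lia.
have cD : (#|A :\ i| <= c)%N by apply: leq_trans cA; apply/subset_leq_card/subsetDl.
have b_gt0D j : j \in A :\ i -> (0 < b j)%N by case/setD1P=> _ /b_gt0.
have sDA : {subset A :\ i <= A} by apply/subsetP/subsetDl.
have : Q A b1 r.
  apply: (IHN _ _ l) => //; apply: pure_power_le Qlr => // j _.
  by rewrite /b1; case: eqP => [->|//]; apply: ltnW.
case/(pure_power_split _ _ Ai) => p; rewrite {2}/b1 eqxx expr1 => Qq1.
have Qq : Q A b (r - p * F i).
  by apply: pure_power_le Qq1 => // j /setD1P[/negPf ne _]; rewrite /b1 ne.
have : Q A b (F i * (F l * p)).
  have -> : F i * (F l * p) = F l * r - F l * (r - p * F i) by ring.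
  by apply: ideal_genB => //; apply: ideal_genM.
case/(pure_power_split _ _ Ai) => q' Qq'.
have Q'p : Q A b' p.
  apply: (IHN _ _ l) => //; apply/(pure_power_split _ _ Ai); exists q'.
  apply: (@pure_power_le (A :\ i) (A :\ i) b) => // [j _|]; first exact: leq_subr.
  apply: (IHN _ _ i) => //; first by rewrite setD11.
  rewrite /b' eqxx; set e := F i ^+ _; suff eb : F i ^+ b i = F i * e.
    by rewrite eb in Qq'; congr (Q _ _ _): Qq'; ring.
  by rewrite -exprS; congr (_ ^+ _); lia.
have -> : r = (r - p * F i) + F i * p by ring.
apply: ideal_genD => //; apply: pure_power_mulF Q'p => j Aj.
by rewrite /b'; have := b_gt0 j Aj; case: (j == i); lia.
Qed.

(** This combines both cases: if [i] is in [A], then one power of [F_i] is taken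
    off a generator; otherwise [F_i] is a nonzerodivisor. *)
Lemma pure_power_colon_form A b i x : (#|A| <= c)%N -> (forall j, j \in A -> 0 < b j)%N ->
  Q A (fun j => b j + (j == i))%N (F i * x) -> Q A b x.
Proof.
move=> cA b_gt0; have [Ai|Ai] := boolP (i \in A); last first.
  move/pure_power_nzd=> /(_ cA Ai) Qx.
  apply: pure_power_le (Qx _) => // j Aj; first by lia.
  by rewrite addn_gt0 b_gt0.
case/(pure_power_split _ _ Ai) => q; rewrite eqxx addn1 => Qq.
apply/(pure_power_split _ _ Ai); exists q.
apply: (@pure_power_nzd _ _ i); rewrite ?setD11 //.
- by apply: leq_trans cA; apply/subset_leq_card/subsetDl.
- by move=> j /setD1P[_ /b_gt0].
- have <- : F i * x - q * F i ^+ (b i).+1 = F i * (x - q * F i ^+ b i).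
    by rewrite exprS; ring.
  by apply: pure_power_le Qq => // j _; apply: leq_addr.
Qed.

Lemma pure_power_colon_monom A u b x :
  (#|A| <= c)%N -> (forall j, j \in A -> 0 < b j)%N ->
  Q A (fun j => u j + b j)%N (mon u * x) -> Q A b x.
Proof.
move=> cA b_gt0; have [N] := ubnP (\sum_j u j); elim: N => // N IHN in u x *.
rewrite ltnS => le_uN.
have [/existsP[i ui]|] := boolP [exists i, 0 < u i]%N; last first.
  move=> u0; have {}u0 i : u i = 0%N.
    by apply/eqP; rewrite -leqn0 leqNgt; apply: contra u0 => ui; apply/existsP; exists i.
  rewrite (eq_monom u0) monom0 mul1r.
  by apply: pure_power_le => // j _; rewrite u0.
rewrite (monom_split ui) -mulrA => Qx; apply: (IHN (fun j => u j - (j == i))%N).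
  by rewrite sum_decr.
apply: (pure_power_colon_form (i := i)) => // [j Aj|].
  by rewrite addn_gt0 b_gt0 ?orbT.
apply: pure_power_le Qx => // j Aj; case: eqP => [->|] /=; lia.
Qed.

(** A substitute for the description of the associated primes of [Q(A, b)]: colon
    ideals of [Q(A, b)] are contained in colon ideals of [P_A].  If [f] remains outside the ideal when an exponent is lowered to 1,
    induction applies to [f]; otherwise [f = p F_i] modulo [Q(A, b)] and it
    applies to [p]. *)
Lemma pure_power_colon_sub A b f : (#|A| <= c)%N -> (forall j, j \in A -> 0 < b j)%N ->
  ~ Q A b f -> exists r, ~ PJ A r /\ forall g, Q A b (g * f) -> PJ A (g * r).
Proof.
move=> cA; have [N] := ubnP (\sum_(j in A) b j); elim: N => // N IHN in b f *.
rewrite ltnS => le_bN b_gt0 Qf.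
have [/exists_inP[i Ai b_gt1]|] := boolP [exists i in A, 1 < b i]%N; last first.
  move=> b_le1; have b1 j : j \in A -> b j = 1%N.
    move=> Aj; apply/eqP; rewrite eqn_leq b_gt0 // andbT leqNgt.
    by apply: contra b_le1 => b_gt1; apply/exists_inP; exists j.
  have Qb1 h : Q A b h <-> PJ A h by split; apply: pure_power_le => // j Aj; rewrite b1.
  by exists f; split=> [/Qb1|g /Qb1].
pose b' j := (b j - (j == i))%N.
have b'_gt0 j : j \in A -> (0 < b' j)%N.
  by rewrite /b'; case: eqP => [->|_ /b_gt0]; rewrite ?subn0 ?subn_gt0.
have lt_b' : (\sum_(j in A) b' j < N)%N by rewrite sum_decr // ltnW.
pose b1 j := if j == i then 1%N else b j.
have b1_gt0 j : j \in A -> (0 < b1 j)%N by rewrite /b1; case: eqP => // _ /b_gt0.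
have lt_b1 : (\sum_(j in A) b1 j < N)%N.
  apply: leq_trans le_bN; rewrite (bigD1 i) //= [X in (_ < X)%N](bigD1 i) //= /b1 eqxx.
  rewrite (eq_bigr b) => [|j /andP[_ /negPf ->]] //.
  by lia.
have [Q1f|Q1f] := classic (Q A b1 f); last first.
  have [r [Pr Hr]] := IHN _ _ lt_b1 b1_gt0 Q1f; exists r; split=> // g Qg.
  apply: Hr; apply: pure_power_le Qg => // j _.
  by rewrite /b1; case: eqP => [->|//]; apply: ltnW.
case/(pure_power_split _ _ Ai): Q1f => p; rewrite {2}/b1 eqxx expr1 => Qq1.
have Qq : Q A b (f - p * F i).
  apply: pure_power_le Qq1 => [|j /setD1P[/negPf ne _]]; last by rewrite /b1 ne.
  exact/subsetP/subsetDl.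
have [|r [Pr Hr]] := IHN b' p lt_b' b'_gt0.
  move=> Q'p; apply: Qf; have -> : f = (f - p * F i) + F i * p by ring.
  apply: ideal_genD => //; apply: pure_power_mulF Q'p => j Aj.
  by rewrite /b'; have := b_gt0 j Aj; case: (j == i); lia.
exists r; split=> // g Qg; apply/Hr/(pure_power_colon_form (i := i)) => //.
have -> : F i * (g * p) = g * f - g * (f - p * F i) by ring.
have Qp : Q A b (g * f - g * (f - p * F i)).
  by apply: ideal_genB => //; apply: ideal_genM.
apply: pure_power_le Qp => // j Aj; rewrite /b'; have := b_gt0 j Aj; case: (j == i); lia.
Qed.

End PurePowers.

(** * Noetherian rings *)

(** The ascending chain condition in terms of elements: there is no
    infinite sequence all of whose terms lie outside the ideal of their
    predecessors. *)
Definition noetherian (R : comNzRingType) : Prop :=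
  forall f : nat -> R,
  exists i, ideal_gen (fun g => exists2 j, (j < i)%N & g = f j) (f i).

Lemma ideal_gen_morph (A B : comNzRingType) (phi : {rmorphism A -> B})
    (S : A -> Prop) (S' : B -> Prop) :
  (forall f, S f -> S' (phi f)) -> forall f, ideal_gen S f -> ideal_gen S' (phi f).
Proof.
move=> SS'; apply: ideal_gen_min => [|f /SS' /ideal_gen_mem //].
split=> [|f g Sf Sg|r f Sf]; rewrite ?rmorph0 ?rmorphD ?rmorphM.
- exact: ideal_gen0.
- exact: ideal_genD.
- exact: ideal_genM.
Qed.

Lemma noetherian_surj (A B : comNzRingType) (phi : {rmorphism A -> B}) :
  (forall y, exists x, phi x = y) -> noetherian A -> noetherian B.
Proof.
move=> /(fun H y => constructive_indefinite_description _ (H y)) pre noethA f.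
have [i fi] := noethA (fun i => sval (pre (f i))); exists i.
rewrite -(svalP (pre (f i))); apply: ideal_gen_morph fi => _ [j ji ->].
by exists j => //; apply: (svalP (pre (f j))).
Qed.

Lemma ex_minimal_size (T : Type) (size : T -> nat) (P : T -> Prop) :
  (exists x, P x) -> exists x, P x /\ forall y, P y -> (size x <= size y)%N.
Proof.
move=> [x]; have [N] := ubnP (size x); elim: N => // N IHN in x * => le_xN Px.
have [[y [Py lt_yx]]|min_x] := classic (exists y, P y /\ (size y < size x)%N).
  by apply: IHN Py; apply: leq_trans lt_yx _.
exists x; split=> // y Py; rewrite leqNgt; apply/negP => lt_yx.
by apply: min_x; exists y.
Qed.

(** Hilbert's basis theorem. A bad sequence in [R[X]] may be replaced by a bad
    sequence [h] that always picks an element of least degree; the leading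
    coefficients of [h] are then bad as well, because a relation among them
    would allow the degree of some [h i] to be lowered. *)
Lemma noetherian_poly (R : comNzRingType) : noetherian R -> noetherian {poly R}.
Proof.
move=> noethR f; apply: NNPP => bad_f.
have {}bad_f i : ~ ideal_gen (fun g => exists2 j, (j < i)%N & g = f j) (f i).
  by move=> fi; apply: bad_f; exists i.
pose I := ideal_gen (fun g => exists j, g = f j).
pose span (s : seq {poly R}) := ideal_gen (fun g => g \in s).
have I_bounded g : I g -> exists N, ideal_gen (fun g => exists2 j, (j < N)%N & g = f j) g.
  move: g; apply: ideal_gen_min => [|_ [j ->]]; last first.
    by exists j.+1; apply: ideal_gen_mem; exists j.
  split; first by exists 0%N; apply: ideal_gen0.
    move=> g h [N gN] [N' hN]; exists (maxn N N'); apply: ideal_genD.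
      by apply: ideal_gen_sub gN => _ [j jN ->]; exists j => //; rewrite leq_max jN.
    by apply: ideal_gen_sub hN => _ [j jN ->]; exists j => //; rewrite leq_max jN orbT.
  by move=> r g [N gN]; exists N; apply: ideal_genM.
have next_ex s : exists h, (forall g, g \in s -> I g) ->
    [/\ I h, ~ span s h &
        forall h', I h' -> ~ span s h' -> (size h <= size h')%N].
  have [sI|nsI] := classic (forall g, g \in s -> I g); last by exists 0.
  have [N sN] : exists N, forall g, g \in s ->
      ideal_gen (fun g => exists2 j, (j < N)%N & g = f j) g.
    elim: s sI => [|g s IHs] sI; first by exists 0%N.
    have [|N sN] := IHs; first by move=> h hs; apply: sI; rewrite inE hs orbT.
    have [|N' gN] := I_bounded g; first by apply: sI; rewrite mem_head.
    exists (maxn N N') => h; rewrite inE => /predU1P[->|/sN hN].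
      by apply: ideal_gen_sub gN => _ [j jN ->]; exists j => //; rewrite leq_max jN orbT.
    by apply: ideal_gen_sub hN => _ [j jN ->]; exists j => //; rewrite leq_max jN.
  have [|h [[Ih sh] min_h]] := @ex_minimal_size _ (fun h : {poly R} => size h)
      (fun h => I h /\ ~ span s h).
    exists (f N); split; first by apply: ideal_gen_mem; exists N.
    by move/(ideal_gen_min (ideal_gen_ideal _) sN); apply: bad_f.
  by exists h => _; split=> // h' Ih' sh'; apply: min_h.
pose next s := sval (constructive_indefinite_description _ (next_ex s)).
have nextP s := svalP (constructive_indefinite_description _ (next_ex s)).
rewrite -/next in nextP.
pose S n := iter n (fun s => rcons s (next s)) [::].
pose h n := next (S n).
(* [S n] lists the terms of [h] before [h n]. *)
have S_h n : S n = mkseq h n by elim: n => // n IHn; rewrite mkseqS -IHn.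
have S_I n g : g \in S n -> I g.
  elim: n g => // n IHn g; rewrite /= mem_rcons inE => /predU1P[->|/IHn //].
  by case: (nextP (S n) IHn).
have h_I n : I (h n) by case: (nextP (S n) (S_I n)).
have h_bad n : ~ span (S n) (h n) by case: (nextP (S n) (S_I n)).
have h_min n h' : I h' -> ~ span (S n) h' -> (size (h n) <= size h')%N.
  by case: (nextP (S n) (S_I n)) => _ _; apply.
have S_mem j i : (j < i)%N -> h j \in S i.
  by move=> ji; rewrite S_h; apply: map_f; rewrite mem_iota.
have le_size j i : (j < i)%N -> (size (h j) <= size (h i))%N.
  move=> ji; apply: h_min => // hi; apply: (h_bad i).
  apply: ideal_gen_sub hi => g; rewrite !S_h => /mapP[l + ->].
  by rewrite mem_iota => /andP[_ lj]; rewrite -S_h; apply/S_mem/(ltn_trans lj).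
have h_gt0 j : (0 < size (h j))%N.
  rewrite size_poly_gt0; apply/eqP => h0; apply: (h_bad j).
  by rewrite h0; apply: ideal_gen0.
have [i] := noethR (fun i => lead_coef (h i)).
(* Any combination of earlier leading coefficients occurs in the degree of [h i]
   within the ideal of the earlier terms. *)
have lower a : ideal_gen (fun g => exists2 j, (j < i)%N & g = lead_coef (h j)) a ->
    exists q, [/\ span (S i) q, (size q <= size (h i))%N & q`_(size (h i)).-1 = a].
  move: a; apply: ideal_gen_min => [|_ [j ji ->]]; last first.
    exists ('X^(size (h i) - size (h j)) * h j); split.
    - by apply/ideal_genM/ideal_gen_mem/S_mem.
    - apply: leq_trans (size_polyMleq _ _) _; rewrite size_polyXn addSn /=.
      by rewrite (subnK (le_size _ _ ji)).
    - rewrite mulrC coefMXn ifF; last by have := h_gt0 j; have := le_size _ _ ji; lia.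
      rewrite lead_coefE; congr (_`_ _); have := h_gt0 j; have := le_size _ _ ji; lia.
  split.
  - by exists 0; split; rewrite ?size_poly0 ?coef0 //; apply: ideal_gen0.
  - move=> a b [q [Sq szq <-]] [q' [Sq' szq' <-]]; exists (q + q'); split.
    + exact: ideal_genD.
    + by apply: leq_trans (size_polyD _ _) _; rewrite geq_max szq.
    + by rewrite coefD.
  - move=> r a [q [Sq szq <-]]; exists (r%:P * q); split.
    + exact: ideal_genM.
    + by rewrite mul_polyC; apply: leq_trans (size_scale_leq _ _) _.
    + by rewrite coefCM.
case/lower=> q [Sq szq qi].
have : (size (h i) <= size (h i - q)%R)%N.
  apply: h_min => [|Shq].
    exact: ideal_genB (h_I i) (ideal_gen_min (ideal_gen_ideal _) (S_I i) Sq).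
  by apply: (h_bad i); rewrite -(subrK q (h i)); apply: ideal_genD.
apply/negP; rewrite -ltnNge -(prednK (h_gt0 i)) ltnS.
apply/leq_sizeP => j; rewrite leq_eqVlt => /predU1P[<-|lt_j].
  by rewrite coefB qi lead_coefE subrr.
have {}lt_j : (size (h i) <= j)%N by rewrite -(prednK (h_gt0 i)).
by rewrite coefB !nth_default ?subrr // (leq_trans szq).
Qed.

Lemma noetherian_mpoly (k : fieldType) n : noetherian {mpoly k[n]}.
Proof.
elim: n => [|n IHn].
  move=> f; have [f0|f0] := eqVneq (f 0%N) 0.
    by exists 0%N; rewrite f0; apply: ideal_gen0.
  exists 1%N; rewrite -(mulr1 (f 1%N)); apply: ideal_genM.
  have c_neq0 : (f 0%N)@_0%MM != 0.
    by apply: contra f0 => /eqP c0; rewrite (nvar0_mpolyC (f 0%N)) c0 mpolyC0.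
  have -> : 1 = ((f 0%N)@_0%MM)^-1%:MP * f 0%N.
    by rewrite {2}(nvar0_mpolyC (f 0%N)) -mpolyCM mulVf.
  by apply/ideal_genM/ideal_gen_mem; exists 0%N.
pose phi : {rmorphism {poly {mpoly k[n]}} -> {mpoly k[n.+1]}} :=
  horner_eval 'X_ord_max \o map_poly (@mwiden n k).
apply: (@noetherian_surj _ _ phi); last exact: noetherian_poly.
have imX i : exists x, phi x = 'X_i.
  case: (unliftP ord_max i) => [j|] ->.
    exists ('X_j)%:P; rewrite /phi /= map_polyC /horner_eval hornerC /= mwidenX mnmwiden1.
    by congr 'X_[U_(_)]; apply: val_inj; rewrite /= /bump leqNgt ltn_ord.
  by exists 'X; rewrite /phi /= map_polyX /horner_eval hornerX.
move=> y; elim/mpolyind: y => [|a m p _ _ [x <-]].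
  by exists 0; rewrite rmorph0.
have [xm Exm] : exists x, phi x = 'X_[m].
  rewrite mpolyXE_id.
  apply: (big_ind (fun y => exists x, phi x = y)) => [|_ _ [y <-] [z <-]|i _].
  - by exists 1; rewrite rmorph1.
  - by exists (y * z); rewrite rmorphM.
  - by have [z <-] := imX i; exists (z ^+ m i); rewrite rmorphXn.
exists ((a%:MP)%:P * xm + x); rewrite rmorphD rmorphM Exm -mul_mpolyC; congr (_ * _ + _).
by rewrite /phi /= map_polyC /horner_eval hornerC /= mwidenC.
Qed.

(** The annihilators of nonzero multiples of [f] in [R / I] satisfy the ascending
    chain condition, and a maximal one is prime: if [x y] kills [g f] but neither
    factor does, then [y g f] has the larger annihilator. *)
Lemma associated_prime_above (R : comNzRingType) (I : R -> Prop) (f : R) :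
  noetherian R -> is_ideal I -> ~ I f ->
  exists g, prime_ideal (fun x => I (x * (g * f))).
Proof.
move=> noethR I_id nIf; apply: NNPP => no_prime.
have [I0 ID IM] := I_id.
have colon_id g : is_ideal (fun x => I (x * g)).
  have [C0 CD CM] := colon_ideal g I_id.
  by split=> [|x y|r x]; rewrite ![_ * g]mulrC; [exact: C0 | exact: CD | exact: CM].
have step_ex g : exists p : R * R, ~ I (g * f) ->
    [/\ ~ I (p.1 * g * f), I (p.2 * (p.1 * g * f)) & ~ I (p.2 * (g * f))].
  have [nIg|Ig] := classic (~ I (g * f)); last by exists (0, 0).
  apply: NNPP => no_step; apply: no_prime; exists g; split=> //; first by rewrite mul1r.
  move=> x y Ixy; apply: NNPP => /not_or_and[nx ny]; apply: no_step.
  by exists (y, x) => _ /=; rewrite -mulrA in Ixy; rewrite -(mulrA y); split.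
pose step g := sval (constructive_indefinite_description _ (step_ex g)).
have stepP g := svalP (constructive_indefinite_description _ (step_ex g)).
rewrite -/step in stepP.
pose G n := iter n (fun g => (step g).1 * g) 1.
have nIG n : ~ I (G n * f).
  by elim: n => [|n IHn]; [rewrite mul1r | case: (stepP (G n) IHn)].
pose a n := (step (G n)).2.
have colon_mono i n x : (i <= n)%N -> I (x * (G i * f)) -> I (x * (G n * f)).
  move=> /subnK <-; elim: (n - i)%N => //= d IHd /IHd Ix.
  by rewrite -mulrA mulrCA; apply: IM.
have [i] := noethR a.
case: (stepP (G i) (nIG i)) => _ _ nai; apply: contra_not nai => ai.
apply: (ideal_gen_min (I := fun x => I (x * (G i * f)))) ai => // _ [j ji ->].
apply: (colon_mono j.+1) => //=.
by case: (stepP (G j) (nIG j)).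
Qed.

(** * Symbolic powers of the intersection ideal *)

Section Localization.

Variable R : idomainType.
Implicit Types (P I : R -> Prop) (f r : R).
Local Notation "x %:F" := (tofrac x).

Lemma prime_ideal_prod P : prime_ideal P -> forall f g, ~ P f -> ~ P g -> ~ P (f * g).
Proof. by case=> _ _ Pm f g Pf Pg /Pm[]. Qed.

Lemma prime_ideal_exp P : prime_ideal P -> forall f m, ~ P f -> ~ P (f ^+ m).
Proof.
move=> prP f m Pf; elim: m => [|m IHm]; first by case: prP.
by rewrite exprS; apply: prime_ideal_prod.
Qed.

Lemma nonmember_neq0 P : prime_ideal P -> forall b, ~ P b -> b != 0.
Proof. by case=> [[P0 _ _] _ _] b; apply: contra_notN => /eqP ->. Qed.

(** Clearing denominators: in a domain, [I R_P] contracts to the elements that some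
    element outside [P] multiplies into [I]. *)
Lemma ideal_extensionP P I f : prime_ideal P -> is_ideal I ->
  ideal_extension P I (tofrac f) <-> exists b, ~ P b /\ I (b * f).
Proof.
move=> prP I_id; have nz := nonmember_neq0 prP; split; last first.
  move=> [b [Pb Ibf]]; exists [:: (1%:F / b%:F, (b * f)%:F)]; split.
    move=> x; rewrite inE => /eqP ->; split; first by exists 1, b.
    by exists (b * f).
  by rewrite big_seq1 tofracM mulrA divfK ?tofrac_eq0 ?nz // tofrac1 mul1r.
have [I0 ID IM] := I_id.
move=> [l [Hl Ef]].
suff [a [b [Pb Ia Eu]]] : exists a b, [/\ ~ P b, I a & tofrac f = a%:F / b%:F].
  exists b; split=> //; have -> : b * f = a; last by [].
  by apply/eqP; rewrite -tofrac_eq tofracM Eu mulrC divfK // tofrac_eq0 nz.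
rewrite {f}Ef; elim: l Hl => [|x l IHl] Hl.
  by exists 0, 1; split=> //; rewrite ?big_nil ?tofrac0 ?mul0r //; case: prP.
have [|a [b [Pb Ia El]]] := IHl; first by move=> y yl; apply: Hl; rewrite inE yl orbT.
have [|[a1 [b1 [Pb1 E1]]] [a2 [Ia2 E2]]] := Hl x; first by rewrite mem_head.
exists (a1 * a2 * b + a * b1), (b1 * b); split.
- exact: prime_ideal_prod.
- by apply: ID; rewrite mulrC; apply: (IM) => //; apply: IM.
- rewrite big_cons El E1 E2 mulrAC -tofracM addf_div ?tofrac_eq0 ?nz //.
  by rewrite -!tofracM -tofracD.
Qed.

Lemma symbolic_power_ideal (I : R -> Prop) m : is_ideal (symbolic_power I m).
Proof.
have Im_id : is_ideal (ideal_pow I m) by apply: ideal_gen_ideal.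
have [I0 ID IM] := Im_id.
split=> [|f g If Ig|r f If] P assP; have [prP _] := assP; apply/ideal_extensionP => //.
- by exists 1; rewrite mulr0; split=> //; case: prP.
- have /ideal_extensionP[//|//|b [Pb Ibf]] := If P assP.
  have /ideal_extensionP[//|//|b' [Pb' Ibg]] := Ig P assP.
  exists (b' * b); split; first exact: prime_ideal_prod.
  have -> : b' * b * (f + g) = b' * (b * f) + b * (b' * g) by ring.
  by apply: ID; apply: (IM).
- have /ideal_extensionP[//|//|b [Pb Ibf]] := If P assP.
  by exists b; split=> //; rewrite mulrCA; apply: IM.
Qed.

End Localization.

Section StarIdeal.

Variables (R : idomainType) (s c : nat) (F : 'I_s -> R).
Local Notation mon := (monom F).
Local Notation Q := (pure_power_ideal F).
Local Notation PJ A := (pure_power_ideal F A (fun=> 1%N)).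
Local Notation I := (star_ideal c F).
Implicit Types (A J : {set 'I_s}) (a e : 'I_s -> nat) (f r : R).

Hypothesis R_noeth : noetherian R.
Hypothesis F_nzd : forall A l r, (#|A| <= c)%N -> l \notin A ->
  PJ A (F l * r) -> PJ A r.

(** The product of the forms outside [J].  It lies in every [P_J'] with [J'] of the
    size of [J] and different from [J], and it is a nonzerodivisor modulo [P_J]:
    multiplication by it moves questions about [R / P_J] to the star ideal. *)
Definition cofactor_form J : R := mon (fun l => l \notin J).

Lemma cofactor_nzd J r : (#|J| <= c)%N -> PJ J (cofactor_form J * r) -> PJ J r.
Proof.
move=> cJ Jr; apply: (pure_power_colon_monom F_nzd (u := fun l => l \notin J)) => //.
by apply: pure_power_le Jr => // j ->.
Qed.

Lemma cofactor_star J r : #|J| = c -> PJ J r -> I (cofactor_form J * r).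
Proof.
move=> cJ Jr J' cJ'; rewrite -[ideal_gen _]/(PJ J').
have [<-|ne] := eqVneq J J'; first exact: ideal_genM.
have /subsetPn[l J'l Jl] : ~~ (J' \subset J).
  by apply: contra ne => sJ'J; rewrite eq_sym eqEcard sJ'J cJ cJ' leqnn.
rewrite mulrC; apply: ideal_genM.
apply: (monom_in_pure_power F (b := fun=> 1%N) (a := fun l => l \notin J) J'l).
by rewrite Jl.
Qed.

(** With [y] the cofactor form, the annihilator of [y h] modulo the star ideal is
    that of [h] modulo [P_J]. *)
Lemma associated_prime_star J h P : #|J| = c -> prime_ideal P ->
  (forall g, P g <-> PJ J (g * h)) -> associated_prime I P.
Proof.
move=> cJ prP Ph; split=> //; exists (cofactor_form J * h) => g.
rewrite mulrCA Ph; split=> [|Ig]; first exact: cofactor_star.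
by apply: cofactor_nzd (Ig J cJ); rewrite cJ.
Qed.

(** If the associated prime, the annihilator of [f], contained all cofactor forms,
    then [f] would lie in every [P_J], since each cofactor form is a nonzerodivisor
    modulo its [P_J]. *)
Lemma associated_prime_cofactor P : associated_prime I P ->
  exists J, #|J| = c /\ ~ P (cofactor_form J).
Proof.
case=> [[_ P1 _] [f Pf]]; apply: NNPP => noJ; apply/P1/Pf; rewrite mul1r => J cJ.
apply: (@cofactor_nzd J); first by rewrite cJ.
have /Pf /(_ J cJ) // : P (cofactor_form J).
by apply: NNPP => PJ; apply: noJ; exists J.
Qed.

(** The products of the cofactor form with the [F j], [j] in [J], belong to the
    star ideal, and [m] such factors can be split off. *)
Lemma cofactor_pow_monom J m a : #|J| = c -> (m <= \sum_(j in J) a j)%N ->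
  ideal_pow I m (cofactor_form J ^+ m * mon a).
Proof.
move=> cJ; elim: m a => [|m IHm] a le_ma; first exact: ideal_pow0.
have [j Jj aj] : exists2 j, j \in J & (0 < a j)%N.
  apply/exists_inP; apply: contraLR le_ma => /exists_inPn a0.
  by rewrite big1 // => j /a0; rewrite -eqn0Ngt => /eqP.
rewrite (monom_split F aj) exprS mulrACA.
apply: ideal_powS.
  by apply: cofactor_star => //; apply: (pure_power_mem F (fun=> 1%N)).
by apply: IHm; rewrite -ltnS sum_decr.
Qed.

Lemma monom_symbolic m a :
  (forall J, #|J| = c -> m <= \sum_(j in J) a j)%N -> symbolic_power I m (mon a).
Proof.
move=> le_m P assP; have [prP _] := assP.
have [J [cJ PJ]] := associated_prime_cofactor assP.
apply/ideal_extensionP => //; first exact: ideal_gen_ideal.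
exists (cofactor_form J ^+ m); split; first exact: prime_ideal_exp.
exact/cofactor_pow_monom/le_m.
Qed.

(** By the pigeonhole principle, a product of [m] forms indexed by [J] contains
    some [F j] more than [e j] times. *)
Lemma prod_in_pure_power J e m (v : 'I_m -> R) : (\sum_(j in J) e j < m)%N ->
  (forall i, PJ J (v i)) -> Q J (fun j => (e j).+1) (\prod_(i < m) v i).
Proof.
elim: m e v => // m IHm e v lt_em Jv; rewrite big_ord_recl mulrC.
set rest := \prod_(i < m) _; move: (v ord0) (Jv ord0).
apply: ideal_gen_min => [|_ [j Jj ->]]; first exact/colon_ideal/ideal_gen_ideal.
rewrite mulrC expr1; have [ej0|ej] := posnP (e j).
  rewrite mulrC; apply: ideal_genM.
  by have := pure_power_mem F (fun j => (e j).+1) Jj; rewrite ej0.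
apply: (pure_power_mulF (b' := fun i => (e i - (i == j)).+1)).
  by move=> i _; case: eqP => [->|] /=; lia.
apply: IHm => [|i]; last exact: Jv.
by rewrite -ltnS sum_decr.
Qed.

(** If [f] were outside [Q(J, e + 1)], there would be an [r] outside [P_J] such
    that [b f] in [Q(J, e + 1)] implies [b r] in [P_J].  A prime annihilator of a
    multiple of [r] modulo [P_J] is associated to the star ideal, and a
    denominator [b] for [f] at this prime would belong to it. *)
Lemma symbolic_power_in_pure_power m J e f : #|J| = c -> (\sum_(j in J) e j < m)%N ->
  symbolic_power I m f -> Q J (fun j => (e j).+1) f.
Proof.
move=> cJ lt_em If; apply: NNPP => Qf.
have cJ' : (#|J| <= c)%N by rewrite cJ.
have [//|r [Jr sub_r]] := pure_power_colon_sub F_nzd cJ' _ Qf.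
have [g prP] := associated_prime_above R_noeth (ideal_gen_ideal _) Jr.
have assP : associated_prime I (fun x => PJ J (x * (g * r))).
  exact: (associated_prime_star (h := g * r) cJ prP).
have /ideal_extensionP[//||b [Pb Ibf]] := If _ assP; first exact: ideal_gen_ideal.
apply: Pb; rewrite mulrCA; apply/ideal_genM/sub_r.
move: Ibf; apply: ideal_gen_min (ideal_gen_ideal _) _ _ => _ [v [Iv ->]].
by apply: prod_in_pure_power => // i; apply: Iv.
Qed.

End StarIdeal.

(** * A shelling of the exponents below a given order *)

Section Shelling.

Variables (s c : nat).
Hypotheses (c_gt0 : (0 < c)%N) (le_cs : (c <= s)%N).
Implicit Types (J : {set 'I_s}) (a u w : 'I_s -> nat) (j l p : 'I_s).

(** Every exponent [a] is assigned the [c]-subset on which it is smallest.  The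
    position [j] is added to break ties, so that weights at different positions
    differ and this subset is unique; the factor [s * s] exceeds any sum of [c]
    positions, so that the order of [a] can be read off its [level]. *)
Definition weight a j : nat := s * s * a j + j.

Definition weight_sum a J : nat := \sum_(j in J) weight a j.

Definition light_set a : {set 'I_s} :=
  [arg min_(J < [set i in take c (enum 'I_s)] | #|J| == c) weight_sum a J].

Definition level a : nat := weight_sum a (light_set a).

Lemma light_setP a : #|light_set a| = c /\
  forall J, #|J| = c -> (level a <= weight_sum a J)%N.
Proof.
rewrite /level /light_set; case: arg_minnP => [|J /eqP cJ min_J].
  by rewrite cardsE (card_uniqP (take_uniq _ (enum_uniq _))) size_takel ?size_enum_ord.
by split=> // J' cJ'; apply: min_J; apply/eqP.
Qed.

Lemma card_light_set a : #|light_set a| = c.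
Proof. by case: (light_setP a). Qed.

Lemma level_le a J : #|J| = c -> (level a <= weight_sum a J)%N.
Proof. by case: (light_setP a) => _; apply. Qed.

Lemma weight_inj a : injective (weight a).
Proof.
have small (i : 'I_s) : (i < s * s)%N.
  by rewrite (leq_trans (ltn_ord i)) // leq_pmulr // (leq_trans _ (ltn_ord i)).
move=> i j /(congr1 (modn^~ (s * s)%N)); rewrite /weight !(mulnC (s * s)) !modnMDl.
by rewrite !modn_small // => /val_inj.
Qed.

(** Exchanging [j] for [l] would otherwise give a lighter subset. *)
Lemma min_weight_separated a J : #|J| = c ->
  (forall J', #|J'| = c -> weight_sum a J <= weight_sum a J')%N ->
  forall j l, j \in J -> l \notin J -> (weight a j < weight a l)%N.
Proof.
move=> cJ min_J j l Jj Jl; rewrite ltn_neqAle; apply/andP; split.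
  by apply: contraNneq Jl => /weight_inj <-.
have lJ : l \notin J :\ j by rewrite in_setD1 (negPf Jl) andbF.
have := min_J (l |: (J :\ j)); rewrite cardsU1 lJ -cJ (cardsD1 j J) Jj => /(_ erefl).
rewrite /weight_sum big_setU1 //= (big_setD1 j Jj) /=.
by rewrite leq_add2r.
Qed.

Lemma separated_uniq a J J' : #|J| = c -> #|J'| = c ->
  (forall j l, j \in J -> l \notin J -> weight a j < weight a l)%N ->
  (forall j l, j \in J' -> l \notin J' -> weight a j < weight a l)%N -> J = J'.
Proof.
move=> cJ cJ' sepJ sepJ'; apply/eqP; rewrite eqEcard cJ cJ' leqnn andbT.
apply: contraT => /subsetPn[j Jj J'j].
have /subsetPn[l J'l Jl] : ~~ (J' \subset J).
  apply: contra J'j => sJ'J; have /eqP -> // : J' == J.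
  by rewrite eqEcard sJ'J cJ cJ' leqnn.
by have := ltn_trans (sepJ _ _ Jj Jl) (sepJ' _ _ J'l J'j); rewrite ltnn.
Qed.

Lemma light_set_separated a j l :
  j \in light_set a -> l \notin light_set a -> (weight a j < weight a l)%N.
Proof. exact: min_weight_separated (card_light_set a) (level_le a) j l. Qed.

Lemma light_set_eq a J : #|J| = c ->
  (forall j l, j \in J -> l \notin J -> weight a j < weight a l)%N -> light_set a = J.
Proof.
move=> cJ sepJ; apply: separated_uniq (card_light_set a) cJ _ sepJ.
exact: light_set_separated.
Qed.

Lemma light_set_uniq a J : #|J| = c -> (weight_sum a J <= level a)%N -> light_set a = J.
Proof.
move=> cJ leJ; apply: light_set_eq => // j l; apply: min_weight_separated => // J' cJ'.
exact/(leq_trans leJ)/level_le.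
Qed.

Lemma weight_incr a j i :
  weight (fun l => a l + (l == j))%N i = (weight a i + s * s * (i == j))%N.
Proof. by rewrite /weight mulnDr addnAC. Qed.

(** Increasing a coordinate in the light set raises the weight of all [c]-subsets
    containing it; the other ones were strictly heavier. *)
Lemma level_incr a j : j \in light_set a ->
  (level a < level (fun l => a l + (l == j)))%N.
Proof.
move=> aj; set a' := fun l => _; set J := light_set a'.
have cJ : #|J| = c := card_light_set a'.
have -> : level a' = (weight_sum a J + \sum_(i in J) s * s * (i == j))%N.
  by rewrite -big_split; apply: eq_bigr => i _; rewrite weight_incr.
have [Jj|Jj] := boolP (j \in J).
  rewrite (bigD1 j Jj) /= eqxx muln1 addnA; apply: leq_trans (leq_addr _ _).
  rewrite -addn1 leq_add ?level_le // muln_gt0 andbb.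
  exact: leq_ltn_trans (ltn_ord j).
apply: leq_trans (leq_addr _ _); rewrite ltnNge; apply: contra Jj.
by move=> /(light_set_uniq cJ) <-.
Qed.

Lemma order_of_level a m J : (s * s * m <= level a)%N -> #|J| = c ->
  (m <= \sum_(j in J) a j)%N.
Proof.
move=> le_m cJ; rewrite leqNgt; apply/negP => lt_m.
have := leq_trans le_m (level_le a cJ).
rewrite /weight_sum big_split /= -big_distrr /= leqNgt => /negP[].
have s_gt0 : (0 < s)%N by apply: leq_trans le_cs.
have lt_J : (\sum_(j in J) j < s * s)%N.
  apply: (@leq_ltn_trans (\sum_(j in J) s.-1)%N).
    by apply: leq_sum => j _; rewrite -ltnS prednK.
  rewrite sum_nat_const cJ; apply: (@leq_ltn_trans (s * s.-1)%N).
    by rewrite leq_mul2r le_cs orbT.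
  by rewrite ltn_pmul2l // prednK.
apply: leq_trans (_ : _ <= s * s * (\sum_(j in J) a j).+1)%N _; last first.
  by rewrite leq_mul2l lt_m orbT.
by rewrite mulnS addnC ltn_add2r.
Qed.

Lemma order_lt_of_level a m : (level a < s * s * m)%N ->
  (\sum_(j in light_set a) a j < m)%N.
Proof.
move=> lt_m; have : (s * s * (\sum_(j in light_set a) a j) < s * s * m)%N.
  apply: leq_ltn_trans lt_m; rewrite /level /weight_sum big_split /= -big_distrr /=.
  exact: leq_addr.
by rewrite ltn_mul2l => /andP[].
Qed.

(** The apexes of the cells: off the light set every coordinate is as small as it
    can be for a light set whose heaviest position is [p]. *)
Definition tight u : bool :=
  [exists p in light_set u, [forall l,
     if l \in light_set u then (weight u l <= weight u p)%N
     else u l == (u p + (l < p))%N]].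

Lemma tightP u : reflect (exists2 p, p \in light_set u &
    (forall l, l \in light_set u -> weight u l <= weight u p)%N /\
    (forall l, l \notin light_set u -> u l = u p + (l < p))%N) (tight u).
Proof.
apply: (iffP exists_inP) => [[p up /forallP pP]|[p up [pP pQ]]]; exists p => //.
  split=> l ul; have := pP l; first by rewrite ul.
  by rewrite (negPf ul) => /eqP.
by apply/forallP => l; case: ifPn => [/pP|/pQ/eqP].
Qed.

Lemma eq_level a b : a =1 b -> level a = level b /\ light_set a = light_set b.
Proof.
move=> eq_ab; have eq_w j : weight a j = weight b j by rewrite /weight eq_ab.
have eq_J : light_set a = light_set b.
  apply: light_set_eq => [|j l]; first exact: card_light_set.
  by rewrite !eq_w; apply: light_set_separated.
by split=> //; rewrite /level eq_J; apply: eq_bigr => j _; rewrite eq_w.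
Qed.

Lemma eq_tight a b : a =1 b -> tight a = tight b.
Proof.
move=> eq_ab; have eq_w j : weight a j = weight b j by rewrite /weight eq_ab.
have [_ eq_J] := eq_level eq_ab; rewrite /tight eq_J; apply: eq_existsb => p.
by congr (_ && _); apply: eq_forallb => l; rewrite !eq_w !eq_ab.
Qed.

Lemma weight_ltP a b p l : p != l ->
  (weight a p < weight b l)%N = (a p + (l < p) <= b l)%N.
Proof.
move=> ne_pl; have := ltn_ord p; have := ltn_ord l; have : nat_of_ord p <> l.
  by move/val_inj/eqP; apply/negP.
rewrite /weight => ne ls ps; have ss : (s <= s * s)%N by nia.
have [lt_ab|lt_ba|<-] := ltngtP (a p) (b l).
- have := leq_mul (leqnn (s * s)) lt_ab; rewrite mulnS => le_s.
  by apply/idP/idP; case: (l < p)%N; lia.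
- have := leq_mul (leqnn (s * s)) lt_ba; rewrite mulnS => le_s.
  by apply/idP/idP; case: (l < p)%N; lia.
- by rewrite ltn_add2l; case: (ltngtP l p) => /=; lia.
Qed.

(** The apex of the cell of [a] arises by capping [a] off its light set. *)
Lemma tight_below a : exists u,
  [/\ forall i, (u i <= a i)%N, level u = level a & tight u].
Proof.
set J := light_set a; have cJ : #|J| = c := card_light_set a.
have [j0 Jj0] : exists j, j \in J by apply/set0Pn; rewrite -card_gt0 cJ.
have [p Jp max_p] : exists2 p, p \in J &
    forall l, l \in J -> (weight a l <= weight a p)%N.
  by case: (@arg_maxnP _ j0 (mem J) (weight a)) => // p Jp max_p; exists p.
pose u l := if l \in J then a l else (a p + (l < p))%N.
have uJ l : l \in J -> weight u l = weight a l by move=> Jl; rewrite /weight /u Jl.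
have ne_p l : l \notin J -> p != l by apply: contraNneq => <-.
have EJ : light_set u = J.
  apply: light_set_eq => // j l Jj Jl; rewrite uJ //.
  apply: (leq_ltn_trans (max_p j Jj)); rewrite weight_ltP ?ne_p //.
  by rewrite /u (negPf Jl).
exists u; split.
- move=> l; rewrite /u; case: ifPn => // Jl.
  by rewrite -(weight_ltP a a) ?ne_p //; apply: light_set_separated.
- by rewrite /level EJ; apply: eq_bigr.
- apply/tightP; rewrite EJ; exists p => //; split=> l Jl; first by rewrite !uJ ?max_p.
  by rewrite /u Jp (negPf Jl).
Qed.

Lemma tight_determined u w : tight u -> tight w -> light_set u = light_set w ->
  (forall j, j \in light_set u -> u j = w j) -> u =1 w.
Proof.
move=> /tightP[p up [max_p off_u]] /tightP[q wq [max_q off_w]] eqJ equw.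
have eq_w j : j \in light_set u -> weight u j = weight w j.
  by move=> uj; rewrite /weight equw.
have eq_pq : p = q.
  apply: (@weight_inj u); apply/eqP; rewrite eqn_leq; apply/andP; split.
    by rewrite eq_w // eq_w ?eqJ //; apply: max_q; rewrite -eqJ.
  by apply: max_p; rewrite eqJ.
move=> l; have [|ul] := boolP (l \in light_set u); first exact: equw.
by rewrite off_u // off_w -?eqJ // -eq_pq equw.
Qed.

Lemma tight_bound u m : tight u -> (level u < s * s * m)%N -> forall i, (u i <= m)%N.
Proof.
move=> /tightP[p up [_ off_u]] /order_lt_of_level lt_m.
have Ju j : j \in light_set u -> (u j < m)%N.
  by move=> uj; apply: leq_ltn_trans lt_m; rewrite (bigD1 j) //= leq_addr.
move=> i; have [/Ju/ltnW //|ui] := boolP (i \in light_set u).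
by rewrite off_u //; have := Ju p up; case: (i < p)%N; lia.
Qed.

(** This is what makes descending level a shelling order: an apex [w] of at least
    the level of [u] exceeds [u] somewhere on the light set of [u].  If it did
    not, the light set of [u] would have weight at most [level w] for [w], hence
    be the light set of [w], and the two apexes would agree on it. *)
Lemma not_dominated u w : (level u <= level w)%N -> tight u -> tight w ->
  (forall j, j \in light_set u -> w j <= u j)%N -> u =1 w.
Proof.
move=> le_uw tu tw le_wu; have cJ := card_light_set u.
have le_wt j : j \in light_set u -> (weight w j <= weight u j)%N.
  by move=> uj; rewrite /weight leq_add2r leq_mul2l le_wu ?orbT.
have le_sum : (weight_sum w (light_set u) <= level u)%N by apply: leq_sum.
have eqJ : light_set w = light_set u.
  by apply: light_set_uniq => //; apply: leq_trans le_sum le_uw.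
apply: tight_determined => // j uj; apply/eqP; rewrite eqn_leq le_wu // andbT leqNgt.
apply/negP => lt_j; have : (level w < level u)%N; last by rewrite ltnNge le_uw.
rewrite /level eqJ /weight_sum (bigD1 j) //= [X in (_ < X)%N](bigD1 j) //=.
rewrite -addSn leq_add //; last by apply: leq_sum => i /andP[/le_wt].
have := ltn_ord j; rewrite /weight; nia.
Qed.

End Shelling.

(** For variables [F i], this says that [F^a] lies in every [P_J ^ m]. *)
Definition has_order (s c : nat) (m : nat) (a : 'I_s -> nat) : Prop :=
  forall J : {set 'I_s}, #|J| = c -> (m <= \sum_(j in J) a j)%N.

Definition exponents (s m : nat) (u : {ffun 'I_s -> 'I_m.+1}) : 'I_s -> nat :=
  fun i => u i.

Section Peeling.

Variables (R : comNzRingType) (s c m : nat) (F : 'I_s -> R).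
Hypotheses (c_gt0 : (0 < c)%N) (le_cs : (c <= s)%N).
Local Notation mon := (monom F).
Local Notation Q := (pure_power_ideal F).
Local Notation PJ A := (pure_power_ideal F A (fun=> 1%N)).
Local Notation tight := (tight c).
Local Notation level := (level c).

Hypothesis F_nzd : forall (A : {set 'I_s}) l r, (#|A| <= c)%N -> l \notin A ->
  PJ A (F l * r) -> PJ A r.

Implicit Types (W : seq {ffun 'I_s -> 'I_m.+1}) (u w : {ffun 'I_s -> 'I_m.+1}).

(** The monomials of order at least [m], together with the apexes that have not
    been discarded yet. *)
Definition order_ideal_plus W : R -> Prop := ideal_gen (fun g =>
  (exists a, has_order c m a /\ g = mon a) \/ exists2 u, u \in W & g = mon (exponents u)).

(** It suffices that [W] contains the apex of the cell of [a], which has the same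
    level as [a]. *)
Lemma monom_in_plus W a :
  (forall w, tight (exponents w) -> level (exponents w) = level a ->
     (level (exponents w) < s * s * m)%N -> w \in W) ->
  order_ideal_plus W (mon a).
Proof.
move=> wW; have [le_m|lt_m] := leqP (s * s * m)%N (level a).
  by apply: ideal_gen_mem; left; exists a; split=> // J; apply: order_of_level.
have [b [le_ba eq_ba tb]] := tight_below c_gt0 le_cs a.
have le_bm : forall i, (b i < m.+1)%N.
  by apply: (tight_bound c_gt0 le_cs tb); rewrite eq_ba.
pose w : {ffun 'I_s -> 'I_m.+1} := [ffun i => Ordinal (le_bm i)].
have eq_wb : exponents w =1 b by move=> i; rewrite /exponents ffunE.
rewrite (monom_le F le_ba); apply/ideal_genM/ideal_gen_mem; right; exists w.
  have [Lw _] := eq_level le_cs eq_wb.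
  by apply: wW; rewrite ?(eq_tight le_cs eq_wb) // Lw eq_ba.
exact: eq_monom.
Qed.

(** Let [J] be the light set of [u] and [f = g + r F^u].  By [not_dominated] all
    remaining monomials lie in [Q(J, u + 1)], hence so does [r F^u]; cancelling
    [F^u] gives [r] in [P_J].  The multiples [F^u F_j] with [j] in [J] have
    larger level than [u] and are therefore multiples of remaining monomials. *)
Lemma order_ideal_peel u W f :
  tight (exponents u) -> (level (exponents u) < s * s * m)%N -> u \notin W ->
  (forall w, w \in W ->
     tight (exponents w) /\ (level (exponents u) <= level (exponents w))%N) ->
  (forall w, tight (exponents w) -> (level (exponents w) < s * s * m)%N ->
     (level (exponents u) < level (exponents w))%N -> w \in W) ->
  Q (light_set c (exponents u)) (fun j => (exponents u j).+1) f ->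
  order_ideal_plus (u :: W) f -> order_ideal_plus W f.
Proof.
move=> tu lt_um uW tW upW Qf.
set J := light_set c (exponents u); have cJ : #|J| = c by apply: card_light_set.
move=> If; have : ideal_gen (fun g => ((exists a, has_order c m a /\ g = mon a) \/
     exists2 w, w \in W & g = mon (exponents w)) \/ g = mon (exponents u)) f.
  apply: ideal_gen_sub If => g [Ha|[w]]; first by left; left.
  by rewrite inE => /predU1P[->|wW] ->; [right | left; right; exists w].
case/ideal_genU1 => r Ir; rewrite -(subrK (r * mon (exponents u)) f).
apply: ideal_genD => //; rewrite mulrC.
have sub_Q g : order_ideal_plus W g -> Q J (fun j => (exponents u j).+1) g.
  move: g; apply: ideal_gen_min (ideal_gen_ideal _) _ => _ [[a [a_m ->]]|[w wW ->]].
    have [j Jj uj] : exists2 j, j \in J & (exponents u j < a j)%N.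
      apply/exists_inP; have := a_m J cJ; apply: contraLR => /exists_inPn le_au.
      rewrite -ltnNge; apply: leq_ltn_trans (order_lt_of_level lt_um).
      by apply: leq_sum => j /le_au; rewrite -leqNgt.
    exact: monom_in_pure_power Jj uj.
  have [tw le_uw] := tW w wW.
  have [j Jj uj] : exists2 j, j \in J & (exponents u j < exponents w j)%N.
    apply/exists_inP; apply: contraNT uW => /exists_inPn le_wu.
    have eq_uw : exponents u =1 exponents w.
      by apply: (not_dominated c_gt0 le_cs) => // j /le_wu; rewrite -leqNgt.
    suff -> : u = w by [].
    by apply/ffunP => i; apply: val_inj; apply: eq_uw.
  exact: monom_in_pure_power Jj uj.
have Jr : PJ J r.
  apply: (pure_power_colon_monom F_nzd (u := exponents u)) => //; first by rewrite cJ.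
  have : Q J (fun j => (exponents u j).+1) (mon (exponents u) * r).
    have -> : mon (exponents u) * r = f - (f - r * mon (exponents u)) by ring.
    by apply: ideal_genB => //; apply: sub_Q.
  by apply: pure_power_le => // j _; rewrite addn1.
move: r Jr {Ir}; apply: ideal_gen_min => [|_ [j Jj ->]].
  exact/colon_ideal/ideal_gen_ideal.
rewrite expr1 -(monom1 F) -monomD; apply: monom_in_plus => w tw Ew lt_w.
by apply: upW => //; rewrite Ew; apply: level_incr.
Qed.

(** The apexes are discarded by increasing level.  The full list spans everything,
    as it contains the apex of the cell of 0. *)
Lemma in_order_ideal f :
  (forall (J : {set 'I_s}) (e : 'I_s -> nat), #|J| = c -> (\sum_(j in J) e j < m)%N ->
     Q J (fun j => (e j).+1) f) ->
  ideal_gen (fun g => exists a, has_order c m a /\ g = mon a) f.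
Proof.
move=> Qf.
suff : order_ideal_plus [::] f by apply: ideal_gen_sub => g [|[]].
pose le_level u w := (level (exponents u) <= level (exponents w))%N.
have trans_level : transitive le_level by move=> ? ? ?; apply: leq_trans.
pose W0 := sort le_level [seq u : {ffun 'I_s -> 'I_m.+1} <- enum {ffun 'I_s -> 'I_m.+1} |
                           tight (exponents u) && (level (exponents u) < s * s * m)%N].
have inW0 w : (w \in W0) = tight (exponents w) && (level (exponents w) < s * s * m)%N.
  by rewrite mem_sort mem_filter mem_enum andbT.
have srtW0 : sorted le_level W0 by apply: sort_sorted => u w; apply: leq_total.
have uniqW0 : uniq W0 by rewrite sort_uniq filter_uniq ?enum_uniq.
have upW0 u w : u \in W0 -> tight (exponents w) -> (level (exponents w) < s * s * m)%N ->
    (level (exponents u) < level (exponents w))%N -> w \in W0.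
  by move=> _ tw lt_w _; rewrite inW0 tw.
have {}inW0 w : w \in W0 ->
    tight (exponents w) /\ (level (exponents w) < s * s * m)%N.
  by rewrite inW0 => /andP[].
have : order_ideal_plus W0 f.
  rewrite -(mulr1 f) -(monom0 F); apply/ideal_genM/monom_in_plus => w tw _ lt_w.
  by rewrite mem_sort mem_filter tw lt_w mem_enum.
elim: W0 srtW0 uniqW0 inW0 upW0 => //= u W IHW srtW /andP[uW uniqW] inW upW If.
have [tu lt_u] := inW u (mem_head _ _).
have le_u w : w \in W -> (level (exponents u) <= level (exponents w))%N.
  by move=> wW; apply: (allP (order_path_min trans_level srtW)).
have upW' x w : x \in u :: W -> tight (exponents w) ->
    (level (exponents w) < s * s * m)%N ->
    (level (exponents x) < level (exponents w))%N -> w \in W.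
  move=> xW tw lt_w lt_xw; have := upW x w xW tw lt_w lt_xw.
  rewrite inE => /predU1P[Ew|//]; have : (level (exponents u) <= level (exponents x))%N.
    by case/predU1P: xW => [->|/le_u].
  by rewrite -Ew leqNgt lt_xw.
apply: IHW => //.
- exact: path_sorted srtW.
- by move=> w wW; apply: inW; rewrite inE wW orbT.
- by move=> x w xW; apply: (upW' x); rewrite inE xW orbT.
apply: order_ideal_peel If => //.
- by move=> w wW; split; [case: (inW w); rewrite // inE wW orbT | apply: le_u].
- by move=> w tw lt_w lt_uw; apply: (upW' u); rewrite ?mem_head.
- by apply: Qf; [apply: card_light_set | apply: order_lt_of_level].
Qed.

End Peeling.

(** * Minimal exponents of a given order *)

Lemma superset_card (T : finType) (A : {set T}) n : (#|A| <= n <= #|T|)%N ->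
  exists B : {set T}, A \subset B /\ #|B| = n.
Proof.
case/andP=> le_An le_nT.
have le_C : (n - #|A| <= #|~: A|)%N by have := cardsC A; lia.
pose D := [set x in take (n - #|A|) (enum (~: A))].
have cD : #|D| = (n - #|A|)%N.
  by rewrite cardsE (card_uniqP (take_uniq _ (enum_uniq _))) size_takel -?cardE.
exists (A :|: D); split; first exact: subsetUl.
rewrite cardsU cD [A :&: D](_ : _ = set0) ?cards0; first lia.
apply/setP => x; rewrite !inE; apply/negP => /andP[Ax /mem_take].
by rewrite mem_enum inE Ax.
Qed.

Section MinimalExponents.

Variables (s c m : nat).
Hypotheses (c_gt0 : (0 < c)%N) (lt_cs : (c < s)%N) (m_gt0 : (0 < m)%N).
Implicit Types (J : {set 'I_s}) (a u w : 'I_s -> nat).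

(** The maximum of such a vector is [t], because fewer than [c < s] of its entries
    are smaller. *)
Definition minimal_exponent (t : nat) u : bool :=
  [&& [forall i, u i <= t], #|[set i | u i < t]| < c & \sum_i u i == t * (s - c) + m]%N.

Lemma eq_minimal_exponent t u w : u =1 w -> minimal_exponent t u = minimal_exponent t w.
Proof.
move=> eq_uw; congr [&& _, _ & _].
- by apply: eq_forallb => i; rewrite eq_uw.
- by congr (_ < c)%N; apply: eq_card => i; rewrite !inE eq_uw.
- by congr (_ == _); apply: eq_bigr.
Qed.

Lemma sum_setC J a : (\sum_i a i = \sum_(i in J) a i + \sum_(i in ~: J) a i)%N.
Proof.
by rewrite (bigID (mem J)) /=; congr (_ + _)%N; apply: eq_bigl => i; rewrite inE.
Qed.

Lemma card_setC_ord J : #|J| = c -> #|~: J| = (s - c)%N.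
Proof.
move=> cJ; have := cardsC J; rewrite card_ord cJ => E.
by apply/eqP; rewrite -(eqn_add2l c) E subnKC // ltnW.
Qed.

(** As long as possible, a largest entry [a i0] is lowered.  When this is impossible,
    some [c]-subset [J] containing [i0] has sum exactly [m]; exchanging [i0]
    for [l] shows that all entries off [J] are maximal, too. *)
Lemma minimal_exponent_below a : has_order c m a ->
  exists u t, [/\ forall i, (u i <= a i)%N, minimal_exponent t u & (t <= m)%N].
Proof.
have [N] := ubnP (\sum_i a i); elim: N => // N IHN in a * => le_aN a_m.
have s_gt0 : (0 < s)%N by apply: leq_ltn_trans lt_cs.
have [i0 _ max_i0] := @arg_maxnP _ (Ordinal s_gt0) predT a isT.
have max_a i : (a i <= a i0)%N := max_i0 i isT.
have [[J [Ji0 cJ sumJ]]|noJ] :=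
    classic (exists J, [/\ i0 \in J, #|J| = c & \sum_(i in J) a i = m]%N).
  have off_J l : l \notin J -> a l = a i0.
    move=> Jl; apply/eqP; rewrite eqn_leq max_a //=.
    have lJ : l \notin J :\ i0 by rewrite in_setD1 (negPf Jl) andbF.
    have := a_m (l |: (J :\ i0)); rewrite cardsU1 lJ -cJ (cardsD1 i0 J) Ji0 => /(_ erefl).
    by rewrite -sumJ big_setU1 //= (big_setD1 i0 Ji0) /= leq_add2r.
  exists a, (a i0); split=> //; last by rewrite -sumJ (bigD1 i0) //= leq_addr.
  apply/and3P; split.
  - by apply/forallP => i; apply: max_a.
  - rewrite -cJ (cardsD1 i0 J) Ji0 ltnS; apply/subset_leq_card/subsetP => i.
    rewrite !inE => lt_i; apply/andP; split.
      by apply: contraTneq lt_i => ->; rewrite ltnn.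
    by apply: contraTT lt_i => /off_J ->; rewrite ltnn.
  - rewrite (sum_setC J) sumJ (eq_bigr (fun=> a i0)) => [|i]; last first.
      by rewrite inE => /off_J.
    by rewrite sum_nat_const card_setC_ord // addnC mulnC.
have a_gt0 : (0 < a i0)%N.
  have [|J [_ cJ]] := @superset_card _ (set0 : {set 'I_s}) c.
    by rewrite cards0 card_ord (ltnW lt_cs).
  rewrite lt0n; apply: contraTneq m_gt0 => a0; rewrite -leqNgt.
  apply: leq_trans (a_m J cJ) _; rewrite leqn0 sum_nat_eq0; apply/forall_inP => i Ji.
  by rewrite -leqn0 -a0.
have [||u [t [le_u tu tm]]] := IHN (fun i => a i - (i == i0))%N.
- by rewrite (sum_decr _ a_gt0).
- move=> J cJ; have [Ji0|Ji0] := boolP (i0 \in J); last first.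
    rewrite (eq_bigr a) => [|i Ji]; first exact: a_m.
    by rewrite (_ : (i == i0) = false) ?subn0 //; apply: contraNF Ji0 => /eqP <-.
  rewrite -ltnS sum_decr // ltn_neqAle a_m // andbT.
  by apply/eqP => sumJ; apply: noJ; exists J.
- by exists u, t; split=> // i; apply: leq_trans (le_u i) (leq_subr _ _).
Qed.

Lemma minimal_exponent_order t u : minimal_exponent t u -> has_order c m u.
Proof.
move=> /and3P[/forallP le_ut _ /eqP sum_u] J cJ.
have : (\sum_(i in ~: J) u i <= t * (s - c))%N.
  by rewrite -(card_setC_ord cJ) mulnC -sum_nat_const; apply: leq_sum.
by move: sum_u; rewrite (sum_setC J); lia.
Qed.

(** [J] is a [c]-subset containing all entries below [t], and also an entry equal
    to [t].  A minimal [w] that does not exceed [u] on [J] agrees with [u] there,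
    since the sum over [J] is [m] for [u] and at least [m] for [w]; the total
    degree then makes all entries of [w] off [J] equal to its maximum, which has
    to be [t]. *)
Lemma minimal_exponent_separated t u : minimal_exponent t u -> exists J,
  [/\ #|J| = c, (\sum_(j in J) u j = m)%N &
    forall t' w, minimal_exponent t' w -> (forall j, j \in J -> w j <= u j)%N -> w =1 u].
Proof.
move=> /and3P[/forallP le_ut lt_c /eqP sum_u].
have [|J [sub_J cJ]] := @superset_card _ [set i | u i < t]%N c.
  by rewrite (ltnW lt_c) card_ord (ltnW lt_cs).
have off_J l : l \notin J -> u l = t.
  move=> Jl; apply/eqP; rewrite eqn_leq le_ut leqNgt.
  by apply: contra Jl => lt_l; apply: (subsetP sub_J); rewrite inE.
have sumJ : (\sum_(j in J) u j = m)%N.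
  have := sum_u; rewrite (sum_setC J) [X in (_ + X)%N](eq_bigr (fun=> t)).
    by rewrite sum_nat_const card_setC_ord // mulnC addnC => /addnI.
  by move=> i; rewrite inE => /off_J.
exists J; split=> // t' w tw le_wu.
have w_m := minimal_exponent_order tw cJ.
case/and3P: tw => /forallP le_wt lt_c' /eqP sum_w.
have eq_J j : j \in J -> w j = u j.
  move=> Jj; apply/eqP; rewrite eqn_leq le_wu //= leqNgt; apply/negP => lt_j.
  suff : (\sum_(i in J) w i < m)%N by rewrite ltnNge w_m.
  rewrite -sumJ (bigD1 j) //= [X in (_ < X)%N](bigD1 j) //= -addSn leq_add //.
  by apply: leq_sum => i /andP[/le_wu].
have [j Jj uj] : exists2 j, j \in J & u j = t.
  have /subsetPn[j Jj] : ~~ (J \subset [set i | u i < t]%N).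
    by apply: contraL lt_c => /subset_leq_card; rewrite cJ -leqNgt.
  by rewrite inE -leqNgt => le_j; exists j => //; apply/eqP; rewrite eqn_leq le_ut.
have le_tt' : (t <= t')%N by rewrite -uj -eq_J.
have off_J' l : l \notin J -> w l = t'.
  move=> Jl; apply/eqP; rewrite eqn_leq le_wt leqNgt; apply/negP => lt_l.
  suff : (\sum_(i in ~: J) w i < t' * (s - c))%N.
    move=> lt_S; have := sum_w; rewrite (sum_setC J) (eq_bigr u) // sumJ addnC => /eqP.
    by rewrite eqn_add2r => /eqP E; rewrite E ltnn in lt_S.
  have cl : l \in ~: J by rewrite inE.
  rewrite -(card_setC_ord cJ) mulnC -sum_nat_const.
  rewrite (bigD1 l) //= [X in (_ < X)%N](bigD1 l) //= -addSn leq_add //.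
  exact: leq_sum.
have eq_tt' : t = t'.
  apply/eqP; rewrite eqn_leq le_tt' leqNgt; apply/negP => lt_tt'.
  have : (#|J| <= #|[set i | w i < t']%N|)%N.
    apply/subset_leq_card/subsetP => i Ji; rewrite inE eq_J //.
    exact: leq_ltn_trans lt_tt'.
  by rewrite cJ leqNgt lt_c'.
by move=> l; have [/eq_J //|Jl] := boolP (l \in J); rewrite off_J' // off_J.
Qed.

End MinimalExponents.

Section MinimalMonomials.

Variables (R : idomainType) (s c m : nat) (F : 'I_s -> R).
Hypotheses (c_gt0 : (0 < c)%N) (lt_cs : (c < s)%N) (m_gt0 : (0 < m)%N).
Local Notation mon := (monom F).
Local Notation PJ A := (pure_power_ideal F A (fun=> 1%N)).

Hypothesis R_noeth : noetherian R.
Hypothesis F_nzd : forall (A : {set 'I_s}) l r, (#|A| <= c)%N -> l \notin A ->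
  PJ A (F l * r) -> PJ A r.
Hypothesis F_proper : forall J : {set 'I_s}, #|J| = c -> ~ PJ J 1.

Definition minimal_exponents : {set {ffun 'I_s -> 'I_m.+1}} :=
  [set u | [exists t : 'I_m.+1, minimal_exponent c m t (exponents u)]].

Definition minimal_monomials : seq R :=
  [seq mon (exponents u) | u <- enum minimal_exponents].

Lemma mem_minimal_monomials g : g \in minimal_monomials ->
  exists (u : {ffun 'I_s -> 'I_m.+1}) t,
    minimal_exponent c m t (exponents u) /\ g = mon (exponents u).
Proof.
case/mapP=> u; rewrite mem_enum inE => /existsP[t tu] ->.
by exists u, t.
Qed.

Lemma symbolic_power_generated :
  generates (symbolic_power (star_ideal c F) m) minimal_monomials.
Proof.
move=> f; split=> [If|]; last first.
  apply: ideal_gen_min (symbolic_power_ideal _ _) _ _ => g.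
  case/mem_minimal_monomials=> u [t [tu ->]].
  exact/monom_symbolic/minimal_exponent_order/tu.
have : ideal_gen (fun g => exists a, has_order c m a /\ g = mon a) f.
  apply: in_order_ideal => // [|J e cJ lt_em]; first exact: ltnW.
  exact: symbolic_power_in_pure_power cJ lt_em If.
apply: ideal_gen_min (ideal_gen_ideal _) _ _ => _ [a [a_m ->]].
have [b [t [le_ba tb le_tm]]] := minimal_exponent_below lt_cs m_gt0 a_m.
rewrite (monom_le F le_ba); apply/ideal_genM/ideal_gen_mem.
have le_bm i : (b i < m.+1)%N.
  by rewrite ltnS (leq_trans _ le_tm) //; case/and3P: tb => /forallP.
pose w : {ffun 'I_s -> 'I_m.+1} := [ffun i => Ordinal (le_bm i)].
have eq_wb : exponents w =1 b by move=> i; rewrite /exponents ffunE.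
rewrite -(eq_monom F eq_wb); apply: map_f; rewrite mem_enum inE.
apply/existsP; exists (Ordinal (le_tm : (t < m.+1)%N)).
by rewrite (eq_minimal_exponent _ _ _ eq_wb).
Qed.

(** The other minimal monomials lie in the ideal [Q(J, u + 1)] of a separating [J],
    and [F^u] does not, since cancelling it would put 1 into [P_J]. *)
Lemma minimal_monomial_notin (u : {ffun 'I_s -> 'I_m.+1}) t (S : R -> Prop) :
  minimal_exponent c m t (exponents u) ->
  (forall g, S g -> exists (w : {ffun 'I_s -> 'I_m.+1}) t',
     [/\ minimal_exponent c m t' (exponents w), w <> u & g = mon (exponents w)]) ->
  ~ ideal_gen S (mon (exponents u)).
Proof.
move=> tu SG Su; have [J [cJ _ sep]] := minimal_exponent_separated c_gt0 lt_cs m_gt0 tu.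
apply: (F_proper cJ); apply: (pure_power_colon_monom F_nzd (u := exponents u)).
- by rewrite cJ.
- by [].
rewrite mulr1.
apply: ideal_gen_min (ideal_gen_ideal _) _ _ Su => g /SG[w [t' [tw ne_wu ->]]].
have [j Jj lt_j] : exists2 j, j \in J & (exponents u j < exponents w j)%N.
  apply/exists_inP; apply: contra_notT ne_wu => /exists_inPn le_wu.
  apply/ffunP => i; apply: val_inj; apply: (sep t' (exponents w)) => // j /le_wu.
  by rewrite -leqNgt.
by apply: (monom_in_pure_power F Jj); rewrite addn1.
Qed.

Lemma minimal_monomials_uniq : uniq minimal_monomials.
Proof.
rewrite map_inj_in_uniq ?enum_uniq // => u w.
rewrite !mem_enum !inE => /existsP[t tu] /existsP[t' tw] eq_uw.
apply/eqP; apply: contraT => /eqP ne_uw; exfalso.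
apply: (@minimal_monomial_notin u t (fun g => g = mon (exponents w)) tu).
  by move=> g ->; exists w, t'; split=> // /esym.
by rewrite eq_uw; apply: ideal_gen_mem.
Qed.

Lemma minimal_monomials_minimal (G : seq R) : {subset G <= minimal_monomials} ->
  generates (symbolic_power (star_ideal c F) m) G -> {subset minimal_monomials <= G}.
Proof.
move=> sub_G genG g g_min; have [u [t [tu Eg]]] := mem_minimal_monomials g_min.
apply: contraT => Gg; exfalso.
apply: (@minimal_monomial_notin u t (fun h => h \in G) tu).
  move=> h Gh; have [w [t' [tw Eh]]] := mem_minimal_monomials (sub_G h Gh).
  exists w, t'; split=> // eq_wu; case/negP: Gg.
  by rewrite Eg -eq_wu -Eh.
rewrite -Eg; apply/genG/symbolic_power_generated.
exact: ideal_gen_mem.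
Qed.

End MinimalMonomials.

(** * Minimal homogeneous generators *)

Section Nakayama.

Variables (k : fieldType) (n : nat).
Local Notation R := {mpoly k[n]}.
Implicit Types (J : R -> Prop) (G : seq R) (f g h r : R) (d e : nat).

Lemma dhomog0_const r : r \is 0.-homog -> r = (r@_0%MM)%:MP.
Proof.
move=> r_0; apply/mpolyP => m; rewrite mcoeffC.
have [->|ne_m0] := eqVneq m 0%MM; first by rewrite mulr1.
by rewrite mulr0; apply: dhomog_nemf_coeff r_0 _; rewrite mdeg_eq0.
Qed.

Lemma pihomogM d e r g : g \is e.-homog ->
  pihomog mdeg d (r * g) = if (e <= d)%N then pihomog mdeg (d - e) r * g else 0.
Proof.
move=> g_e; pose N := maxn (msize r) d.+1.
rewrite {1}(pihomog_partitionE (mf := mdeg) (leq_maxl _ _ : msize r <= N)%N).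
rewrite mulr_suml raddf_sum /=.
have term i : pihomog mdeg d (pihomog mdeg i r * g) =
    if (i + e == d)%N then pihomog mdeg i r * g else 0.
  have hom : pihomog mdeg i r * g \is (i + e).-homog.
    by apply: dhomogM => //; apply: pihomogP.
  by case: eqP => [<-|/eqP ne]; [apply: pihomog_dE | apply: pihomog_ne0 ne hom].
rewrite (eq_bigr _ (fun (i : 'I_N) _ => term i)) -big_mkcond /=.
case: leqP => [le_ed|lt_de]; last by rewrite big1 // => i /eqP; lia.
have lt_N : (d - e < N)%N by rewrite leq_max ltnS leq_subr orbT.
rewrite (big_pred1 (Ordinal lt_N)) // => i.
by apply/eqP/eqP => [E|->]; [apply: val_inj; rewrite /= -E addnK | rewrite /= subnK].
Qed.

Lemma pihomog_ideal G d h : (forall g, g \in G -> exists e, g \is e.-homog) ->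
  ideal_gen (fun g => g \in G) h ->
  ideal_gen (fun g => g \in G /\ exists2 e, (e <= d)%N & g \is e.-homog)
    (pihomog mdeg d h).
Proof.
move=> homG; move: h; apply: ideal_gen_terms => [|f g|r g Gg].
- by rewrite raddf0; apply: ideal_gen0.
- by rewrite raddfD; apply: ideal_genD.
- have [e ge] := homG g Gg; rewrite (pihomogM _ _ ge).
  case: leqP => le_ed; last exact: ideal_gen0.
  by apply/ideal_genM/ideal_gen_mem; split=> //; exists e.
Qed.

Lemma minimal_irredundant J G g : minimal_homog_generators J G -> g \in G ->
  ~ ideal_gen (fun h => h \in G /\ h != g) g.
Proof.
case=> _ _ genG minG Gg gen_g.
suff /minG/(_ _ Gg) : generates J (filter (predC1 g) G).
  by rewrite mem_filter /= eqxx => /(_ (mem_subseq (filter_subseq _ _))).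
have in_filter h : h \in filter (predC1 g) G <-> h \in G /\ h != g.
  by rewrite mem_filter andbC; split=> /andP.
move=> f; rewrite genG; split; last first.
  by apply: ideal_gen_sub => h /in_filter[].
apply: ideal_gen_min (ideal_gen_ideal _) _ _ => h Gh.
have [->|ne_hg] := eqVneq h g.
  by apply: ideal_gen_sub gen_g => h' /in_filter.
by apply/ideal_gen_mem/in_filter.
Qed.

Lemma minimal_neq0 J G g : minimal_homog_generators J G -> g \in G -> g != 0.
Proof.
move=> minG Gg; apply/eqP => g0; apply: (minimal_irredundant minG Gg).
by rewrite {2}g0; apply: ideal_gen0.
Qed.

(** Graded Nakayama.  Modulo the ideal [Low] generated in degrees below [d], the
    elements of degree [d] in [G] are scalar combinations of those in [G'].  If
    there were more of the former, a nontrivial linear combination of them would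
    lie in [Low], and one of them would be redundant in [G]. *)
Lemma minimal_count_le J G G' d :
  minimal_homog_generators J G -> minimal_homog_generators J G' ->
  (count (fun g => g \is d.-homog) G <= count (fun g => g \is d.-homog) G')%N.
Proof.
move=> minG minG'; have [uniqG homG genG _] := minG; have [_ homG' genG' _] := minG'.
pose Low := ideal_gen (fun g => g \in G /\ exists2 e, (e < d)%N & g \is e.-homog).
have low e h : (e < d)%N -> J h -> h \is e.-homog -> Low h.
  move=> lt_ed /genG Gh h_e; rewrite -(pihomog_dE h_e).
  apply: ideal_gen_sub (pihomog_ideal e homG Gh) => g [Gg [e' le_e' ge]].
  by split=> //; exists e' => //; apply: leq_ltn_trans lt_ed.
pose D := [seq g <- G | g \is d.-homog]; pose D' := [seq g <- G' | g \is d.-homog].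
rewrite -!size_filter -/D -/D'; set p := size D; set q := size D'.
rewrite leqNgt; apply/negP => lt_qp.
have top_part h : J h -> exists A : 'rV[k]_q,
    Low (pihomog mdeg d h - \sum_(j < q) A 0 j *: D'`_j).
  move/genG'; move: h; apply: ideal_gen_terms => [|f g [A Af] [B Bg]|r g G'g].
  - exists 0; rewrite raddf0 sub0r big1 ?oppr0 => [|j _]; first exact: ideal_gen0.
    by rewrite mxE scale0r.
  - exists (A + B); rewrite raddfD /=.
    under eq_bigr do rewrite mxE scalerDl.
    rewrite big_split /= opprD addrACA; exact: ideal_genD.
  - have [e ge] := homG' g G'g; rewrite (pihomogM _ _ ge).
    have zeroA h : Low h -> exists A : 'rV[k]_q, Low (h - \sum_(j < q) A 0 j *: D'`_j).
      by exists 0; rewrite big1 ?subr0 // => j _; rewrite mxE scale0r.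
    have Jg : J g by apply/genG'/ideal_gen_mem.
    case: ltngtP => [lt_ed|_|eq_ed]; first 1 last.
    + by apply: zeroA; apply: ideal_gen0.
    + pose i := index g D'; have D'g : g \in D' by rewrite mem_filter G'g -eq_ed ge.
      have lt_iq : (i < q)%N by rewrite index_mem.
      pose a := (pihomog mdeg 0 r)@_0%MM.
      have Ea : pihomog mdeg 0 r = a%:MP by apply/dhomog0_const/pihomogP.
      exists (a *: delta_mx 0 (Ordinal lt_iq)).
      rewrite -eq_ed subnn Ea mul_mpolyC (bigD1 (Ordinal lt_iq)) //= big1 => [|j ne_j].
        by rewrite !mxE !eqxx mulr1 nth_index // addr0 subrr; apply: ideal_gen0.
      by rewrite !mxE eqxx (negPf ne_j) mulr0 scale0r.
    + by apply: zeroA; apply: ideal_genM; apply: low lt_ed Jg ge.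
have D_mem (i : 'I_p) : D`_i \in D by apply: mem_nth.
have JD (i : 'I_p) : J D`_i.
  by apply/genG/ideal_gen_mem; have := D_mem i; rewrite mem_filter => /andP[].
have DG (i : 'I_p) : D`_i \in G by have := D_mem i; rewrite mem_filter => /andP[].
have Dd (i : 'I_p) : D`_i \is d.-homog by have := D_mem i; rewrite mem_filter => /andP[].
pose row i := sval (constructive_indefinite_description _ (top_part _ (JD i))).
have rowP i := svalP (constructive_indefinite_description _ (top_part _ (JD i))).
rewrite -/(row _) in rowP.
pose A : 'M[k]_(p, q) := \matrix_(i, j) row i 0 j.
have /rowV0Pn[v v_ker v_neq0] : kermx A != 0.
  rewrite -mxrank_eq0 mxrank_ker -lt0n subn_gt0.
  exact: leq_ltn_trans (rank_leq_col A) lt_qp.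
have /rV0Pn[i0 v_i0] := v_neq0.
have low_v : Low (\sum_(i < p) v 0 i *: D`_i).
  have -> : \sum_(i < p) v 0 i *: D`_i =
      \sum_(i < p) v 0 i *: (pihomog mdeg d D`_i - \sum_(j < q) row i 0 j *: D'`_j).
    under [RHS]eq_bigr => i _ do rewrite scalerBr pihomog_dE //.
    rewrite [RHS]big_split /= -[LHS]addr0; congr (_ + _).
    under eq_bigr => i _ do rewrite scaler_sumr -sumrN.
    rewrite exchange_big /= big1 // => j _.
    have vA : \sum_(i < p) v 0 i * row i 0 j = 0.
      have /matrixP/(_ 0 j) := sub_kermxP v_ker; rewrite !mxE => vA0.
      by rewrite -[RHS]vA0; apply: eq_bigr => i _; rewrite mxE.
    under eq_bigr => i _ do rewrite scalerA -scaleNr.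
    by rewrite -scaler_suml sumrN vA oppr0 scale0r.
  apply: (ideal_sum (ideal_gen_ideal _)) => i _; rewrite -mul_mpolyC.
  exact/ideal_genM/rowP.
apply: (minimal_irredundant minG (DG i0)).
set S := fun h => _.
have Si (i : 'I_p) : i != i0 -> S D`_i.
  move=> ne_i; split=> //; rewrite nth_uniq ?filter_uniq //.
have low_S h : Low h -> ideal_gen S h.
  apply: ideal_gen_sub => g [Gg [e lt_ed ge]]; split=> //.
  apply: contraTneq lt_ed => Eg; rewrite -leqNgt.
  have g0 : g != 0 := minimal_neq0 minG Gg.
  by rewrite (dhomog_uniq g0 ge (e := d)) // Eg.
have -> : D`_i0 = (v 0 i0)^-1%:MP *
    (\sum_(i < p) v 0 i *: D`_i - \sum_(i < p | i != i0) v 0 i *: D`_i).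
  by rewrite (bigD1 i0) //= addrK mul_mpolyC scalerA mulVf // scale1r.
apply/ideal_genM/ideal_genB; first exact: low_S.
rewrite -big_filter; apply: (ideal_sum (ideal_gen_ideal _)) => i.
rewrite mem_filter => /andP[ne_i _]; rewrite -mul_mpolyC.
exact/ideal_genM/ideal_gen_mem/Si.
Qed.

Lemma minimal_count_eq J G G' d :
  minimal_homog_generators J G -> minimal_homog_generators J G' ->
  count (fun g => g \is d.-homog) G = count (fun g => g \is d.-homog) G'.
Proof. by move=> minG minG'; apply/eqP; rewrite eqn_leq !(@minimal_count_le J). Qed.

End Nakayama.

(** * Counting minimal exponents *)

Definition compositions (z n : nat) : nat :=
  #|[set v : z.-tuple 'I_n.+1 | (\sum_(i <- v) i == n)%N]|.

Lemma compositions0 n : compositions 0 n = (n == 0%N).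
Proof.
rewrite /compositions; case: eqP => [->|/eqP n_neq0].
  rewrite (_ : [set _ | _] = setT) ?cardsT ?card_tuple ?expn0 //.
  by apply/setP => v; rewrite !inE tuple0 big_nil.
by apply: eq_card0 => v; rewrite inE tuple0 big_nil eq_sym (negPf n_neq0).
Qed.

Lemma compositionsS z n : compositions z.+1 n = 'C(z + n, n).
Proof. by rewrite /compositions card_ord_partitions -bin_sub ?leq_addr // addKn. Qed.

Lemma compositions_n0 z : compositions z 0 = 1%N.
Proof. by case: z => [|z]; rewrite ?compositions0 // compositionsS bin0. Qed.

Section Counting.

Variables (s m t : nat).
Hypothesis le_tm : (t <= m)%N.
Implicit Types (Z : {set 'I_s}) (u : {ffun 'I_s -> 'I_m.+1}).

Definition constant_off Z n : {set {ffun 'I_s -> 'I_m.+1}} :=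
  [set u | [forall i, (i \notin Z) ==> (exponents u i == t)] &&
           (\sum_(i in Z) exponents u i == n)%N].

(** Listing the entries on [Z] identifies these vectors with compositions. *)
Lemma card_constant_off Z n : (n <= m)%N -> #|constant_off Z n| = compositions #|Z| n.
Proof.
move=> le_nm.
pose ext (v : #|Z|.-tuple 'I_n.+1) : {ffun 'I_s -> 'I_m.+1} :=
  [ffun i => if i \in Z then inord (nth ord0 v (index i (enum Z))) else inord t].
have ext_in v i : i \in Z -> exponents (ext v) i = nth ord0 v (index i (enum Z)).
  move=> Zi; rewrite /exponents ffunE Zi inordK // ltnS.
  by apply: leq_trans le_nm; rewrite -ltnS.
have ext_out v i : i \notin Z -> exponents (ext v) i = t.
  by move=> Zi; rewrite /exponents ffunE (negPf Zi) inordK.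
have sum_ext v : (\sum_(i in Z) exponents (ext v) i = \sum_(x <- v) x)%N.
  rewrite (eq_bigr _ (ext_in v)) -big_enum /= [RHS](big_nth ord0) size_tuple.
  case: (pickP (mem Z)) => [i0 _|Z0]; last first.
    have Z00 : #|Z| = 0%N by apply: eq_card0.
    rewrite [RHS]big_geq ?Z00 // (_ : enum Z = [::]) ?big_nil //.
    by apply: size0nil; rewrite -cardE.
  rewrite (big_nth i0) -cardE big_nat [RHS]big_nat; apply: eq_bigr => j /andP[_ lt_j].
  by rewrite index_uniq ?enum_uniq -?cardE.
rewrite /compositions -(card_in_imset (f := ext)) => [|v w _ _ eq_vw].
  apply: eq_card => u; rewrite inE; apply/andP/imsetP => [[/forallP off /eqP sum_u]|[v]].
    have le_u i : i \in Z -> (u i < n.+1)%N.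
      by move=> Zi; rewrite ltnS -sum_u (bigD1 i) //= leq_addr.
    exists (map_tuple (fun i => inord (u i)) (enum_tuple Z)).
      rewrite inE big_map -[X in _ == X]sum_u -big_enum /=.
      by apply/eqP; rewrite !big_enum /=; apply: eq_bigr => i Zi; rewrite inordK // le_u.
    apply/ffunP => i; apply: val_inj.
    rewrite -[LHS]/(exponents u i) -[RHS]/(exponents (ext _) i).
    have [Zi|Zi] := boolP (i \in Z); last first.
      by rewrite ext_out //; apply/eqP; have := off i; rewrite Zi.
    rewrite ext_in //= (nth_map i) ?index_mem ?mem_enum //.
    by rewrite nth_index ?mem_enum // inordK ?le_u.
  rewrite inE => /eqP sum_v ->; split; last by rewrite sum_ext sum_v.
  by apply/forallP => i; apply/implyP => /ext_out ->.
apply: eq_from_tnth => j; apply: val_inj; have Zj := enum_valP j.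
have idx : index (enum_val j) (enum Z) = j.
  by rewrite (enum_val_nth (enum_val j)) index_uniq ?enum_uniq // -cardE.
by have := ext_in v _ Zj; rewrite eq_vw ext_in // idx => E; rewrite !(tnth_nth ord0) /= E.
Qed.

Variable c : nat.
Hypotheses (c_gt0 : (0 < c)%N) (lt_cs : (c < s)%N) (m_gt0 : (0 < m)%N).

Definition light_indices u : {set 'I_s} := [set i | exponents u i < t]%N.

(** The total degree forces the sum [m - t (c - #|Z|)] on the set [Z] of entries
    below [t]. *)
Lemma minimal_exponent_fiber Z u :
  (minimal_exponent c m t (exponents u) && (light_indices u == Z)) =
  [&& #|Z| < c, t * (c - #|Z|) <= m, u \in constant_off Z (m - t * (c - #|Z|))
    & [forall i in Z, exponents u i < t]]%N.
Proof.
have sumC : (forall i, i \notin Z -> exponents u i = t) ->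
    (\sum_i exponents u i = \sum_(i in Z) exponents u i + t * (s - #|Z|))%N.
  move=> off; rewrite (sum_setC Z).
  rewrite [X in (_ + X)%N](eq_bigr (fun=> t)) => [|i]; last first.
    by rewrite inE => /off.
  rewrite sum_nat_const mulnC; congr (_ + _ * _)%N.
  by have := cardsC Z; rewrite card_ord; lia.
have le_Zs : (#|Z| <= s)%N by have := max_card (mem Z); rewrite card_ord.
have arith : (#|Z| < c)%N -> (t * (s - #|Z|) = t * (s - c) + t * (c - #|Z|))%N.
  by move=> lt_Zc; rewrite -mulnDr; congr (_ * _)%N; lia.
apply/andP/and4P => [[/and3P[/forallP le_t lt_c /eqP sum_u] /eqP EZ]|].
  have off i : i \notin Z -> exponents u i = t.
    by rewrite -EZ inE -leqNgt => le_i; apply/eqP; rewrite eqn_leq le_t.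
  have lt_Zc : (#|Z| < c)%N by rewrite -EZ.
  have := sum_u; rewrite sumC // arith // => sumZ.
  split=> //; first by lia.
    rewrite inE; apply/andP; split; last by apply/eqP; lia.
    by apply/forallP => i; apply/implyP => /off ->.
  by apply/forall_inP => i; rewrite -EZ inE.
case=> lt_Zc le_m; rewrite inE => /andP[/forallP off /eqP sumZ] /forall_inP lt_t.
have {}off i : i \notin Z -> exponents u i = t.
  by move=> Zi; have := off i; rewrite Zi => /eqP.
have EZ : light_indices u = Z.
  apply/setP => i; rewrite inE; have [/lt_t //|Zi] := boolP (i \in Z).
  by rewrite off // ltnn.
split; last exact/eqP.
apply/and3P; split; last by rewrite sumC // arith // sumZ; apply/eqP; lia.
  by apply/forallP => i; have [/lt_t/ltnW //|/off ->] := boolP (i \in Z).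
by rewrite -/(light_indices u) EZ.
Qed.

Definition fiber Z : {set {ffun 'I_s -> 'I_m.+1}} :=
  [set u | minimal_exponent c m t (exponents u) && (light_indices u == Z)].

Lemma card_minimal_exponent :
  #|[set u : {ffun 'I_s -> 'I_m.+1} | minimal_exponent c m t (exponents u)]| =
  (\sum_(Z : {set 'I_s}) #|fiber Z|)%N.
Proof.
rewrite -sum1_card (partition_big light_indices predT) //=.
by apply: eq_bigr => Z _; rewrite -sum1_card; apply: eq_bigl => u; rewrite !inE.
Qed.

Lemma card_fiber_small Z : (m < t * (c - #|Z|))%N -> #|fiber Z| = 0%N.
Proof.
move=> lt_m; apply: eq_card0 => u.
by rewrite inE minimal_exponent_fiber (leqNgt (t * _)) lt_m andbF.
Qed.

Lemma card_fiber_large Z : (c <= #|Z|)%N -> #|fiber Z| = 0%N.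
Proof.
by move=> le_c; apply: eq_card0 => u; rewrite inE minimal_exponent_fiber ltnNge le_c.
Qed.

(** In this range the sum over [Z] is smaller than [t], so that the entries on [Z]
    are automatically smaller than [t]. *)
Lemma card_fiber Z : (#|Z| < c)%N -> (t * (c - #|Z|) <= m < t * (c - #|Z|) + t)%N ->
  #|fiber Z| = compositions #|Z| (m - t * (c - #|Z|)).
Proof.
move=> lt_Zc /andP[le_m lt_m]; rewrite -card_constant_off ?leq_subr //.
apply: eq_card => u; rewrite inE minimal_exponent_fiber lt_Zc le_m /=.
apply: andb_idr; rewrite inE => /andP[_ /eqP sum_u]; apply/forall_inP => i Zi.
have : (exponents u i <= m - t * (c - #|Z|))%N by rewrite -sum_u (bigD1 i) //= leq_addr.
by lia.
Qed.

(** Here the entries on [Z] sum to [t], and the compositions to be excluded are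
    those that have a single nonzero part [t], one for each element of [Z]. *)
Lemma card_fiber_half Z : #|Z|.+1 = c -> m = (2 * t)%N ->
  #|fiber Z| = (compositions c.-1 t - c.-1)%N.
Proof.
move=> cZ Em; have cZ' : (c - #|Z| = 1)%N by lia.
have Et : (m - t * (c - #|Z|) = t)%N by rewrite cZ'; lia.
(* The composition with the single nonzero part [t], at position [j]. *)
pose peak j : {ffun 'I_s -> 'I_m.+1} :=
  [ffun i => if (i \notin Z) || (i == j) then inord t else ord0].
have peakE j i : exponents (peak j) i = if (i \notin Z) || (i == j) then t else 0%N.
  by rewrite /exponents ffunE; case: ifP => // _; rewrite inordK.
have t_gt0 : (0 < t)%N by lia.
have cP : #|peak @: Z| = c.-1.
  rewrite card_in_imset => [|j l Zj Zl /ffunP/(_ j)]; first by rewrite -cZ.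
  move/(congr1 val).
  rewrite -[LHS]/(exponents (peak j) j) -[RHS]/(exponents (peak l) j) !peakE.
  by rewrite eqxx orbT Zj /=; case: eqP => // _ t0; rewrite t0 in t_gt0.
have subP : peak @: Z \subset constant_off Z t.
  apply/subsetP => _ /imsetP[j Zj ->]; rewrite inE; apply/andP; split.
    by apply/forallP => i; apply/implyP => Zi; rewrite peakE Zi.
  rewrite (bigD1 j) //= peakE eqxx orbT big1 ?addn0 // => i /andP[Zi /negPf ne].
  by rewrite peakE Zi ne.
have -> : fiber Z = constant_off Z t :\: (peak @: Z).
  apply/setP => u.
  rewrite in_setD inE minimal_exponent_fiber Et cZ' -cZ ltnSn muln1 le_tm /=.
  rewrite andbC; have [uX|] := boolP (u \in constant_off Z t); last by rewrite !andbF.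
  rewrite !andbT; have := uX; rewrite inE => /andP[/forallP off /eqP sum_u].
  have {}off i : i \notin Z -> exponents u i = t.
    by move=> Zi; have := off i; rewrite Zi => /eqP.
  apply/forall_inP/idP => [lt_t|].
    apply/imsetP => -[j Zj Eu]; have := lt_t j Zj.
    by rewrite Eu peakE eqxx orbT ltnn.
  move=> peak_u j Zj; rewrite ltnNge; apply: contra peak_u => le_t.
  apply/imsetP; exists j => //; apply/ffunP => i; apply: val_inj.
  rewrite -[LHS]/(exponents u i) -[RHS]/(exponents (peak j) i) peakE.
  have sumD : (exponents u j + \sum_(l in Z | l != j) exponents u l = t)%N.
    by have := sum_u; rewrite (bigD1 j Zj).
  have [Zi|/off //] := boolP (i \in Z); rewrite /=.
  have [->|ne_ij] := eqVneq i j; first by apply/eqP; rewrite eqn_leq le_t andbT; lia.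
  have : (exponents u i <= \sum_(l in Z | l != j) exponents u l)%N.
    by rewrite (bigD1 i) ?Zi //= leq_addr.
  by lia.
rewrite cardsD (setIidPr subP) cP card_constant_off //.
by rewrite (_ : c.-1 = #|Z|) // -cZ.
Qed.

Lemma sum_card_const z b :
  (\sum_(Z : {set 'I_s}) (if #|Z| == z then b else 0) = 'C(s, z) * b)%N.
Proof.
rewrite -big_mkcond /= sum_nat_const; congr (_ * _)%N.
by rewrite -[in RHS](card_ord s) -card_draws; apply: eq_card => Z; rewrite inE.
Qed.

Lemma card_minimal_exponent_gt : (m < 2 * t)%N ->
  #|[set u : {ffun 'I_s -> 'I_m.+1} | minimal_exponent c m t (exponents u)]| =
  ('C(s, c.-1) * compositions c.-1 (m - t))%N.
Proof.
move=> lt_m; rewrite card_minimal_exponent -sum_card_const; apply: eq_bigr => Z _.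
have [cZ|ne_cZ] := eqVneq #|Z| c.-1.
  have c1 : (c - #|Z| = 1)%N by lia.
  by rewrite card_fiber ?c1 ?muln1 ?cZ //; lia.
have [/card_fiber_large //|lt_Zc] := leqP c #|Z|.
by apply: card_fiber_small; nia.
Qed.

Lemma card_minimal_exponent_half : m = (2 * t)%N ->
  #|[set u : {ffun 'I_s -> 'I_m.+1} | minimal_exponent c m t (exponents u)]| =
  ((1 < c) * 'C(s, c.-2) + 'C(s, c.-1) * (compositions c.-1 t - c.-1))%N.
Proof.
move=> Em; rewrite card_minimal_exponent [((1 < c) * _)%N]mulnC.
rewrite -!sum_card_const -big_split /=.
apply: eq_bigr => Z _.
have [cZ|ne_cZ] := eqVneq #|Z| c.-1.
  rewrite card_fiber_half //; last by lia.
  by rewrite cZ; case: eqP => // E; have -> : (1 < c)%N = false by lia.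
rewrite addn0; have [cZ|ne_cZ'] := eqVneq #|Z| c.-2.
  have c2 : (c - #|Z| = 2)%N by lia.
  rewrite card_fiber ?c2; try lia.
  rewrite (_ : m - t * 2 = 0)%N ?compositions_n0; last by lia.
  by have -> : (1 < c)%N = true by lia.
have [/card_fiber_large //|lt_Zc] := leqP c #|Z|.
by apply: card_fiber_small; nia.
Qed.

End Counting.

(** * Families of forms that are regular in small numbers *)

Section RegularFamilies.

Variables (R : comNzRingType) (s c : nat) (F : 'I_s -> R).
Hypothesis lt_cs : (c < s)%N.
Hypothesis F_reg : forall js : seq 'I_s, uniq js -> size js = c.+1 ->
  regular_sequence [seq F j | j <- js].
Local Notation PJ A := (pure_power_ideal F A (fun=> 1%N)).

Lemma gen_enumE (A : {set 'I_s}) f :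
  ideal_gen (fun g => g \in [seq F j | j <- enum A]) f <-> PJ A f.
Proof.
split; apply: ideal_gen_sub => g.
  by case/mapP=> j; rewrite mem_enum => Aj ->; exists j.
by case=> j Aj ->; apply: map_f; rewrite mem_enum.
Qed.

(** A regular sequence of length [c + 1] is obtained by listing [A], then [l], then
    arbitrary further indices. *)
Lemma regular_nzd (A : {set 'I_s}) l r : (#|A| <= c)%N -> l \notin A ->
  PJ A (F l * r) -> PJ A r.
Proof.
move=> le_Ac lA.
have cA' : #|l |: A| = #|A|.+1 by rewrite cardsU1 lA.
have [|B [sub_B cB]] := @superset_card _ (l |: A) c.+1.
  by rewrite cA' ltnS le_Ac card_ord.
pose js := enum A ++ l :: enum (B :\: (l |: A)).
have uniq_js : uniq js.
  rewrite cat_uniq /= !enum_uniq !mem_enum (negPf lA) !inE eqxx /= andbT.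
  apply/hasPn => j; rewrite mem_enum !inE negb_or -andbA => /and3P[_ jA _].
  by rewrite /= mem_enum.
have size_js : size js = c.+1.
  rewrite size_cat /= -!cardE cardsD (setIidPr sub_B) cB cA'.
  by rewrite addnS -addSn subnKC.
have [reg _] := F_reg uniq_js size_js.
have := reg #|A|; rewrite size_map size_js ltnS => /(_ le_Ac r).
have -> : take #|A| [seq F j | j <- js] = [seq F j | j <- enum A].
  by rewrite map_cat take_size_cat // size_map -cardE.
have -> : [seq F j | j <- js]`_#|A| = F l.
  by rewrite map_cat nth_cat size_map -cardE ltnn subnn.
by move=> regA /gen_enumE/regA/gen_enumE.
Qed.

Lemma regular_proper (J : {set 'I_s}) : #|J| = c -> ~ PJ J 1.
Proof.
move=> cJ; have [|B [sub_B cB]] := @superset_card _ J c.+1.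
  by rewrite cJ leqnSn card_ord.
have [|_ proper] := F_reg (enum_uniq (mem B)); first by rewrite -cardE.
apply: contra_not proper => PJ1; apply/gen_enumE.
by apply: pure_power_le PJ1 => //; apply/subsetP.
Qed.

Lemma regular_nonunit i r : (0 < c)%N -> r * F i <> 1.
Proof.
move=> c_gt0 rF1; have [|J [Ji cJ]] := @superset_card _ [set i] c.
  by rewrite cards1 c_gt0 card_ord ltnW.
apply: (regular_proper cJ); rewrite -rF1; apply: ideal_genM.
by apply: (pure_power_mem F (fun=> 1%N)); rewrite (subsetP Ji) ?set11.
Qed.

Lemma regular_neq0 i : F i != 0.
Proof.
apply/eqP => Fi0; have [|J [_ cJ]] := @superset_card _ (set0 : {set 'I_s}) c.
  by rewrite cards0 card_ord (ltnW lt_cs).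
apply: (regular_proper cJ); apply: (@pure_power_le _ _ _ set0 _ (fun=> 1%N)) => // [j|].
  by rewrite inE.
by apply: (@regular_nzd set0 i 1); rewrite ?cards0 ?inE // Fi0 mul0r; apply: ideal_gen0.
Qed.

End RegularFamilies.

Section HomogeneousForms.

Variables (k : fieldType) (n s delta : nat) (F : 'I_s -> {mpoly k[n]}).
Hypothesis F_homog : forall i, F i \is delta.-homog.

Lemma monom_homog a : monom F a \is (delta * \sum_i a i).-homog.
Proof.
rewrite big_distrr /=.
apply: (big_rec2 (fun (p : {mpoly k[n]}) d => p \is d.-homog)); first exact: dhomog1.
by move=> i p d _ pd; apply: dhomogM => //; apply: dhomogMn.
Qed.

Lemma monom_homogE a d : (forall i, F i != 0) ->
  (monom F a \is d.-homog) = (d == delta * \sum_i a i)%N.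
Proof.
move=> F_neq0; apply/idP/eqP => [mon_d|->]; last exact: monom_homog.
apply: dhomog_uniq mon_d (monom_homog a); apply/prodf_neq0 => i _.
exact: expf_neq0.
Qed.

End HomogeneousForms.

(** For [c = 1] there are no parts: the convention [binom a 0 = 1] for negative [a]
    counts the empty composition of 0, and [binom (n - 1) n = 0] for [n > 0]. *)
Lemma binz_compositions c n : (0 < c)%N ->
  binz (n%:Z + c%:Z - 2) n%:Z = (compositions c.-1 n)%:Z.
Proof.
case: c => [|[|c]] // _.
  rewrite compositions0; case: n => [|n] //.
  have -> : n.+1%:Z + 1%:Z - 2 = n%:Z by lia.
  by rewrite /= bin_small.
have -> : n%:Z + c.+2%:Z - 2 = (c + n)%:Z by lia.
by rewrite compositionsS.
Qed.

Lemma compositions_ge z n : (0 < n)%N -> (z <= compositions z n)%N.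
Proof.
case: z => // z; case: n => // n _; rewrite compositionsS.
elim: n => [|n IHn]; first by rewrite addn1 bin1.
by rewrite addnS binS (leq_trans IHn) // leq_addl.
Qed.

(** * The number of minimal generators in each degree *)
Theorem theorem7p7 (k : fieldType) (n c s delta m : nat)
    (F : 'I_s -> {mpoly k[n.+1]})
    (hc : (1 <= c)%N) (hcs : (c < s)%N)
    (hF : forall i, F i \is delta.-homog)
    (hreg : forall js : seq 'I_s, uniq js -> size js = c.+1 ->
       regular_sequence [seq F j | j <- js])
    (hm : (1 <= m)%N) :
  (forall t : nat, (m < 2 * t)%N ->
     has_min_generators_of_degree
       (symbolic_power (star_ideal c F) m)
       (delta * (t * (s - c) + m))%N
       (binz s%:Z (c%:Z - 1) * binz (m%:Z - t%:Z + c%:Z - 2) (m%:Z - t%:Z)))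
  /\
  (forall t : nat, m = (2 * t)%N ->
     has_min_generators_of_degree
       (symbolic_power (star_ideal c F) m)
       (delta * (t * (s - c) + m))%N
       (binz s%:Z (c%:Z - 2)
        + binz s%:Z (c%:Z - 1) * (binz (c%:Z - 2 + t%:Z) t%:Z - (c%:Z - 1)))).
Proof.
have nzd := regular_nzd hcs hreg.
have proper := regular_proper hcs hreg.
have F_neq0 := regular_neq0 hcs hreg.
have R_noeth : noetherian {mpoly k[n.+1]} := @noetherian_mpoly k n.+1.
(* Otherwise the forms would be nonzero constants, hence units; positivity is what
   makes the degree determine [t]. *)
have delta_gt0 : (0 < delta)%N.
  have i : 'I_s := Ordinal (leq_ltn_trans (leq0n c) hcs).
  rewrite lt0n; apply: contra_notN (@regular_nonunit _ _ _ _ hcs hreg i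
    ((F i)@_0%MM)^-1%:MP hc) => /eqP delta0.
  have F_const : F i = ((F i)@_0%MM)%:MP.
    by apply: dhomog0_const; have := hF i; rewrite delta0.
  rewrite {2}F_const -mpolyCM mulVf //.
  by have := F_neq0 i; apply: contraNneq => a0; rewrite F_const a0 mpolyC0.
set G := minimal_monomials c m F.
have G_min : minimal_homog_generators (symbolic_power (star_ideal c F) m) G.
  split.
  - exact: minimal_monomials_uniq.
  - move=> g /mem_minimal_monomials[u [t [_ ->]]].
    by eexists; apply: monom_homog.
  - exact: symbolic_power_generated.
  - by move=> G' sub genG'; apply: minimal_monomials_minimal genG'.
have count_G t :
    count (fun g : {mpoly k[n.+1]} => g \is (delta * (t * (s - c) + m)).-homog) G =
    #|[set u : {ffun 'I_s -> 'I_m.+1} |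
       (t <= m)%N && minimal_exponent c m t (exponents u)]|.
  rewrite count_map -size_filter cardE /enum_mem -enumT.
  rewrite -filter_predI; congr size; apply: eq_filter => u /=.
  rewrite !inE (monom_homogE hF) // eqn_pmul2l //; apply/andP/andP.
    case=> /eqP Et /existsP[t' tu]; suff -> : t = t' by split=> //; rewrite -ltnS.
    case/and3P: (tu) => _ _ /eqP Et'; move: Et; rewrite Et' => /addIn /eqP.
    by rewrite eqn_pmul2r ?subn_gt0 // => /eqP.
  case=> le_tm tu; split; first by case/and3P: (tu) => _ _ /eqP ->.
  by apply/existsP; exists (Ordinal (le_tm : (t < m.+1)%N)).
have reduce t N : (#|[set u : {ffun 'I_s -> 'I_m.+1} |
      (t <= m)%N && minimal_exponent c m t (exponents u)]|%:Z = N) ->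
    has_min_generators_of_degree (symbolic_power (star_ideal c F) m)
      (delta * (t * (s - c) + m))%N N.
  move=> <-; split; first by exists G.
  by move=> G' G'_min; rewrite (minimal_count_eq _ G'_min G_min) count_G.
have c_pred : c%:Z - 1 = c.-1%:Z by lia.
split=> t Et; apply: reduce.
  have [le_tm|lt_mt] := leqP t m; last first.
    rewrite (_ : #|_| = 0%N); last by apply: eq_card0 => u; rewrite inE.
    have -> : m%:Z - t%:Z = Negz (t - m).-1 by rewrite NegzE; lia.
    by rewrite mulr0.
  by rewrite /= card_minimal_exponent_gt // c_pred (subzn le_tm) binz_compositions.
have le_tm : (t <= m)%N by lia.
have -> : c%:Z - 2 + t%:Z = t%:Z + c%:Z - 2 by lia.
rewrite binz_compositions // c_pred subzn; last by apply: compositions_ge; lia.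
rewrite le_tm /= card_minimal_exponent_half // PoszD PoszM; congr (_ + _).
case: (c) hc => [|[|c']] // _.
have -> : c'.+2%:Z - 2 = c'%:Z by lia.
exact: mul1r.
Qed.
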